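(* Fix $\kappa\ge 0$. For $\alpha>0$, $q\in[0,1)$, $r\ge0$ define the replica-symmetric functional $$\mathcal F_\kappa(\alpha;q,r)=-\frac{r(1-q)}{2}+\mathbb E\big[\log(2\cosh(\sqrt r\,Z))\big]+\alpha\,\mathbb E\!\left[\log\overline\Phi\!\left(\frac{\kappa-\sqrt q\,Z}{\sqrt{1-q}}\right)\right].$$ For $\alpha\in(0,\alpha_c(\kappa))$ let $(q_\alpha,r_\alpha)\in[0,1)\times[0,\infty)$ be the unique solution of the system $q=P(r)$, $r=R_\kappa(q,\alpha)$, and set $\mathrm{RS}_\star(\alpha,\kappa)=\mathcal F_\kappa(\alpha;q_\alpha,r_\alpha)$. Then $$\lim_{\alpha\uparrow\alpha_c(\kappa)}\mathrm{RS}_\star(\alpha,\kappa)=-\infty.$$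
   Context: Let $Z\sim\mathcal N(0,1)$ be a standard normal random variable, $\phi(u)=\frac{1}{\sqrt{2\pi}}e^{-u^2/2}$, $\Phi(u)=\int_{-\infty}^u\phi(s)\,ds$, $\overline{\Phi}(u)=1-\Phi(u)$, and $(x)_+=\max\{x,0\}$. Define $E(u)=\phi(u)/\overline{\Phi}(u)$ for $u\in\mathbb R$ (the inverse Mills ratio; $\mathbb E$ denotes expectation). For $q\in[0,1)$ and $x\in\mathbb R$ set $$F_q(x)=\frac{1}{\sqrt{1-q}}\,E\!\left(\frac{\kappa-x}{\sqrt{1-q}}\right).$$ For $r\ge 0$ set $P(r)=\mathbb E[\tanh^2(\sqrt r\,Z)]$. For $\alpha>0$, $\kappa\ge0$, $q\in[0,1)$ set $R_\kappa(q,\alpha)=\alpha\,\mathbb E[F_q(\sqrt q\,Z)^2]$. Set $C_\kappa=\mathbb E[(\kappa-Z)_+^2]=(\kappa^2+1)\Phi(\kappa)+\kappa\phi(\kappa)$ and $\alpha_c(\kappa)=\frac{2}{\pi C_\kappa}$. For every $\kappa\ge0$ and $\alpha\in(0,\alpha_c(\kappa))$ the system $q=P(r)$, $r=R_\kappa(q,\alpha)$ has exactly one solution $(q,r)\in[0,1)\times[0,\infty)$ (and it has no solution for $\alpha\ge\alpha_c(\kappa)$), so $(q_\alpha,r_\alpha)$ is well defined. *)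

(* Defs.v *)
From mathcomp Require Import all_boot all_order all_algebra.
From mathcomp Require Import all_classical all_reals all_analysis.
Set Implicit Arguments.
Unset Strict Implicit.
Unset Printing Implicit Defensive.
Import Order.TTheory GRing.Theory Num.Theory.
Import numFieldNormedType.Exports.
Local Open Scope classical_set_scope.
Local Open Scope ring_scope.

Section Definitions.
Context {R : realType}.
Implicit Types (f : R -> R) (u x q r alpha kappa : R).

Definition cosh x : R := (expR x + expR (- x)) / 2.

Definition tanh x : R := (expR x - expR (- x)) / (expR x + expR (- x)).

(* E[f Z] for Z ~ N(0, 1). Every f used below has a finite expectation in the
   stated parameter range, so [fine] loses nothing there. *)
Definition gaussE f : R := fine 'E_(normal_prob (0 : R) (1 : R))[f].

Definition phi u : R := normal_pdf 0 1 u.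

Lemma phiE u : phi u = (Num.sqrt (2 * pi))^-1 * expR (- (u ^+ 2 / 2)).
Proof.
rewrite /phi normal_pdfE ?oner_eq0// /normal_peak /normal_fun.
by rewrite expr1n mul1r subr0 mulNr mulr_natl.
Qed.

Definition Phi u : R := \int[lebesgue_measure]_(s in `]-oo, u]) phi s.

Definition Phibar u : R := 1 - Phi u.

Definition invMills u : R := phi u / Phibar u.

Definition Fq kappa q x : R :=
  (Num.sqrt (1 - q))^-1 * invMills ((kappa - x) / Num.sqrt (1 - q)).

Definition P r : R := gaussE (fun z => tanh (Num.sqrt r * z) ^+ 2).

Definition Rk kappa q alpha : R :=
  alpha * gaussE (fun z => Fq kappa q (Num.sqrt q * z) ^+ 2).

Definition Ckappa kappa : R := gaussE (fun z => Num.max (kappa - z) 0 ^+ 2).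

Definition alpha_c kappa : R := 2 / (pi * Ckappa kappa).

Definition RS_solution kappa alpha q r : Prop :=
  [/\ 0 <= q < 1, 0 <= r, q = P r & r = Rk kappa q alpha].

Definition RS_functional kappa alpha q r : R :=
  - (r * (1 - q) / 2)
  + gaussE (fun z => ln (2 * cosh (Num.sqrt r * z)))
  + alpha * gaussE (fun z =>
      ln (Phibar ((kappa - Num.sqrt q * z) / Num.sqrt (1 - q)))).

End Definitions.

(* Main.v *)
Require Import Defs.
From mathcomp Require Import all_boot all_order all_algebra.
From mathcomp Require Import all_classical all_reals all_analysis.
From mathcomp Require Import measurable_realfun ring lra.
Set Implicit Arguments.
Unset Strict Implicit.
Unset Printing Implicit Defensive.
Import Order.TTheory GRing.Theory Num.Theory.
Import numFieldNormedType.Exports.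
Local Open Scope classical_set_scope.
Local Open Scope ring_scope.

(** Write t = sqrt (1 - q), E = invMills and u = (kappa - sqrt q Z) / t.
    Gaussian integration by parts turns q = P r into sqrt r (1 - q) =
    E[Z tanh (sqrt r Z)] (gaussE_mul_tanh), and r = Rk kappa q alpha reads
    alpha E[E(u)^2] = r (1 - q) (RS_solution_Mills).

    First, r tends to infinity as alpha tends to alpha_c. The quantity
    E[Z tanh (sqrt r Z)] increases with r and stays strictly below E|Z| = 2
    phi 0, whose square is 2 / pi = alpha_c C, where C = Ckappa kappa. On
    the other hand C <= (1 - q) E[E(u)^2], so that alpha C <= r
    (1 - q)^2 = E[Z tanh (sqrt r Z)]^2 (RS_solution_alpha_le): a bound on r
    would keep alpha away from alpha_c.

    The inequality C <= (1 - q) E[E(u)^2] compares two functions of u. By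
    rotation invariance of the Gaussian law (gaussE_rotation), C = (1 - q)
    E[H(u)] with H(v) = E[(v - G)_+^2]. The pointwise inequality H <= E^2
    holds for v >= 0 (meanHinge_le_invMills) but fails near minus infinity.
    The sum over v and - v is nevertheless ordered the right way, H(v) +
    H(- v) = 1 + v^2 <= E(v)^2 + E(- v)^2 (invMills_sqrD), and for
    kappa >= 0 the law of u gives at least as much weight to v >= 0 as
    to - v (gaussE_affine_le). Both inequalities rest on the lower bound of
    Sampford for E (invMills_ge_sampford).

    Second, the functional diverges because its leading terms cancel
    exactly. Up to bounded errors the entropy term is at most E[X tanh X]
    = r (1 - q) with X = sqrt r Z, and log Phibar(u) is at
    most - E(u)^2 / 2, of mean - r (1 - q) / 2 after multiplication by
    alpha; together with - r (1 - q) / 2 they sum to zero. On the event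
    Z <= -1 one has u >= sqrt q / t, and there log Phibar(u) is smaller by a
    further log (sqrt q / t). Since r tends to infinity, q tends to 1 and
    this logarithm tends to infinity on an event of fixed positive
    probability (RS_functional_le). *)

(** * The standard Gaussian density and its expectation *)

Section GaussianDensity.
Context {R : realType}.
Implicit Types (f g : R -> R) (a c x u z : R).

Local Notation mu := (@lebesgue_measure R).
Local Notation N01 := (normal_prob (0 : R) (1 : R)).

Lemma phi_gt0 u : 0 < phi u.
Proof. by rewrite phiE mulr_gt0 ?expR_gt0// invr_gt0 sqrtr_gt0 mulr_gt0// pi_gt0. Qed.

Lemma phi_ge0 u : 0 <= phi u.
Proof. exact/ltW/phi_gt0. Qed.

Lemma phiN u : phi (- u) = phi u.
Proof. by rewrite !phiE sqrrN. Qed.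

Lemma measurable_phi : measurable_fun [set: R] (@phi R).
Proof. exact: measurable_normal_pdf. Qed.

Lemma continuous_phi : continuous (@phi R).
Proof. by apply: continuous_normal_pdf; exact: oner_neq0. Qed.

Lemma is_derive_phi u : is_derive u 1 (@phi R) (- (u * phi u)).
Proof.
have -> : @phi R = fun u => (Num.sqrt (2 * pi))^-1 * expR (- (u ^+ 2 / 2)).
  by apply/funext => v; exact: phiE.
apply: is_derive_eq; rewrite /GRing.scale/=.
by field; rewrite sqrtr_eq0 -ltNge mulr_gt0// pi_gt0.
Qed.

Lemma phi0_sqr : phi (0 : R) ^+ 2 = (2 * pi)^-1.
Proof.
rewrite phiE expr0n/= mul0r oppr0 expR0 mulr1 exprVn sqr_sqrtr//.
by rewrite mulr_ge0// pi_ge0.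
Qed.

(** By uniqueness of the Radon-Nikodym derivative, as the law is defined by its
    density. *)
Lemma integral_N01 (f : R -> \bar R) : measurable_fun [set: R] f ->
  (forall x, 0 <= f x)%E ->
  (\int[N01]_x f x = \int[mu]_x (f x * (phi x)%:E))%E.
Proof.
move=> mf f0; have dom := @normal_prob_dominates R 0 1.
rewrite -(Radon_Nikodym_SigmaFinite.change_of_variables dom)//.
apply: ae_eq_integral => //.
- apply: emeasurable_funM => //; apply: (measurable_int mu).
  exact: Radon_Nikodym_SigmaFinite.f_integrable.
- apply: emeasurable_funM => //; apply/measurable_EFinP; exact: measurable_phi.
- apply: ae_eqe_mul2l; apply: integral_ae_eq => //.
  + exact: Radon_Nikodym_SigmaFinite.f_integrable.
  + by apply/measurable_EFinP; exact: measurable_phi.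
  + by move=> E _ mE; rewrite -Radon_Nikodym_SigmaFinite.f_integral.
Qed.

Lemma gaussE_density f : measurable_fun [set: R] f -> (forall x, 0 <= f x) ->
  gaussE f = fine (\int[mu]_x (f x * phi x)%:E)%E.
Proof.
move=> mf f0; rewrite /gaussE unlock integral_N01//.
exact/measurable_EFinP.
Qed.

Lemma is_derive_Phi u : is_derive u 1 (@Phi R) (phi u).
Proof.
have [] := @continuous_FTC1 R (@phi R) -oo%O u (u + 1).
- by rewrite ltrDl.
- apply: (integrableS measurableT) => //.
  exact: integrable_normal_pdf.
- by rewrite ltNyr.
- exact: continuous_phi.
move=> dF F'; apply: DeriveDef; first exact: dF.
by rewrite -derive1E; exact: F'.
Qed.

Lemma cvg_Phi : Phi x @[x --> +oo%R] --> (1 : R).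
Proof.
have mid : @measurable_fun _ _ (measurableTypeR R) R setT idfun.
  exact: (@measurable_id _ (measurableTypeR R) setT).
pose X : {RV N01 >-> R} :=
  @mfun_Sub _ _ (measurableTypeR R) R idfun (mem_set mid).
by have /fine_cvgP[] := @cvg_cdfy1 _ _ _ N01 X.
Qed.

Lemma cvg_inv_y : x^-1 @[x --> +oo%R] --> (0 : R).
Proof.
apply/cvgrPdist_lt => e e0; near=> x.
rewrite sub0r normrN gtr0_norm ?invr_gt0; last by near: x; exact: nbhs_pinfty_gt.
rewrite invf_plt ?posrE//; first by near: x; apply: nbhs_pinfty_gt; rewrite num_real.
Unshelve. all: by end_near. Qed.

(** The decay of x phi(x) that follows from exp y >= 1 + y. *)
Lemma phi_le_inv x : 0 < x -> x * phi x <= 2 / x.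
Proof.
move=> x0; rewrite phiE.
have c1 : (Num.sqrt (2 * pi))^-1 <= 1 :> R.
  rewrite invf_le1 ?sqrtr_gt0 ?mulr_gt0 ?pi_gt0//.
  rewrite -[leLHS]sqrtr1 ler_sqrt ?mulr_ge0 ?pi_ge0//.
  by have := @pi_ge2 R; lra.
have : expR (- (x ^+ 2 / 2)) <= 2 / x ^+ 2.
  rewrite expRN -[leRHS]invf_div lef_pV2 ?posrE ?expR_gt0 ?divr_gt0 ?exprn_gt0//.
  by apply: le_trans (expR_ge1Dx _); rewrite lerDr.
move=> h; apply: (@le_trans _ _ (x * (2 / x ^+ 2))); last first.
  by rewrite le_eqVlt; apply/orP; left; apply/eqP; field; rewrite gt_eqF.
rewrite ler_pM2l//; apply: le_trans h.
by rewrite ler_piMl ?expR_ge0.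
Qed.

Lemma cvg_xphi : x * phi x @[x --> +oo%R] --> (0 : R).
Proof.
have h2 : 2 / x @[x --> +oo%R] --> (0 : R).
  by rewrite -(mulr0 2); apply: cvgM; [exact: cvg_cst|exact: cvg_inv_y].
apply: (squeeze_cvgr _ (cvg_cst 0) h2); near=> x.
have x0 : 0 < x by near: x; exact: nbhs_pinfty_gt.
by rewrite phi_le_inv// mulr_ge0 ?phi_ge0// ltW.
Unshelve. all: by end_near. Qed.

Lemma cvg_phi : phi x @[x --> +oo%R] --> (0 : R).
Proof.
apply: (squeeze_cvgr _ (cvg_cst 0) cvg_xphi); near=> x.
have x0 : 1 <= x by near: x; exact: nbhs_pinfty_ge.
by rewrite phi_ge0 ler_peMl ?phi_ge0.
Unshelve. all: by end_near. Qed.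

(** Folding the line onto [0, +oo[ makes the one-sided fundamental theorem a
    formula for the whole line. The antiderivative is taken on the open
    half-line, so that |x| phi(x) is covered in spite of the corner at 0. *)
Lemma even_FTC2 f (F : R -> R) (l : R) : (forall x, 0 <= f x) -> continuous f ->
  (forall x, f (- x) = f x) ->
  (forall x, 0 < x -> is_derive x 1 F (f x)) ->
  {for 0, continuous F} -> F x @[x --> +oo%R] --> l ->
  (\int[mu]_x (f x)%:E = (2 * (l - F 0))%:E)%E.
Proof.
move=> f0 cf fN dF cF Fl.
rewrite ge0_symfun_integralT//; last by move=> x; rewrite /= fN.
rewrite -set_itvcy (@ge0_continuous_FTC2y _ f F 0 l)//.
- exact: continuous_subspaceT.
- by move=> x x0; have [] := dF _ x0.
- exact: cvg_at_right_filter.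
- move=> x; rewrite in_itv/= andbT => x0.
  by rewrite derive1E; have := dF _ x0 => ?; rewrite derive_val.
Qed.

Lemma is_derive_continuous (F : R -> R) x d : is_derive x 1 F d ->
  {for x, continuous F}.
Proof. by move=> [dF _]; exact/differentiable_continuous/derivable1_diffP. Qed.

Lemma Phi0 : Phi 0 = 2^-1 :> R.
Proof.
have := @even_FTC2 (@phi R) (@Phi R) 1 phi_ge0 continuous_phi phiN
  (fun x _ => is_derive_Phi x) (is_derive_continuous (is_derive_Phi 0)) cvg_Phi.
rewrite /phi integral_normal_pdf => -[]; lra.
Qed.

Lemma integral_abs_phi :
  (\int[mu]_x (`|x| * phi x)%:E = (2 * phi 0)%:E)%E.
Proof.
rewrite (_ : 2 * phi 0 = 2 * (0 - - phi 0)); last by ring.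
apply: (@even_FTC2 _ (fun x => - phi x) 0).
- by move=> x; rewrite mulr_ge0 ?phi_ge0.
- move=> x; apply: continuousM; last exact: continuous_phi.
  exact: norm_continuous.
- by move=> x; rewrite normrN phiN.
- move=> x x0; have dphi := is_derive_phi x.
  by apply: is_derive_eq; rewrite opprK gtr0_norm.
- by apply: continuousN; exact: continuous_phi.
- by rewrite -oppr0; apply: cvgN; exact: cvg_phi.
Qed.

Lemma integral_sqr_phi :
  (\int[mu]_x (x ^+ 2 * phi x)%:E = 1)%E.
Proof.
have -> : (1%E : \bar R) = (2 * (1 - (Phi 0 - 0 * phi 0)))%:E.
  by congr _%:E; rewrite Phi0; lra.
apply: (@even_FTC2 _ (fun x => Phi x - x * phi x) 1).
- by move=> x; rewrite mulr_ge0 ?phi_ge0 ?sqr_ge0.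
- move=> x; apply: (@continuousM _ _ (fun x : R => x ^+ 2)).
    exact: exprn_continuous.
  exact: continuous_phi.
- by move=> x; rewrite sqrrN phiN.
- move=> x x0; have dphi := is_derive_phi x; have dPhi := is_derive_Phi x.
  by apply: is_derive_eq; rewrite /GRing.scale/=; ring.
- apply: is_derive_continuous; have dphi := is_derive_phi 0.
  have dPhi := is_derive_Phi 0; exact: is_deriveB.
- by rewrite -[X in _ --> X]subr0; apply: cvgB; [exact: cvg_Phi|exact: cvg_xphi].
Qed.

End GaussianDensity.

Section GaussianExpectation.
Context {R : realType}.
Implicit Types (f g : R -> R) (a c x u z : R).

Local Notation mu := (@lebesgue_measure R).
Local Notation N01 := (normal_prob (0 : R) (1 : R)).

(** Growth at most quadratic. The class is stable under the operations used
    below, and on it the extended expectation underlying gaussE is finite,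
    so that [fine] loses nothing and gaussE is linear and monotone. *)
Definition qbounded f := measurable_fun [set: R] f /\
  exists C, forall x, `|f x| <= C * (1 + x ^+ 2).

Lemma integrable_N01_sqrD1 C :
  N01.-integrable setT (EFin \o (fun x => C * (1 + x ^+ 2))).
Proof.
have m2 : measurable_fun [set: R] (fun x : R => x ^+ 2) by exact: exprn_measurable.
have i2 : N01.-integrable setT (EFin \o (fun x => x ^+ 2)).
  apply/integrableP; split; first exact/measurable_EFinP.
  under eq_integral do rewrite /= ger0_norm ?sqr_ge0//.
  rewrite integral_N01//; last 2 first.
  - exact/measurable_EFinP.
  - by move=> x; rewrite lee_fin sqr_ge0.
  under eq_integral do rewrite -EFinM.
  by rewrite integral_sqr_phi ltry.
have i1 : N01.-integrable setT (EFin \o (fun x => 1 + x ^+ 2)).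
  have := integrableD measurableT (finite_measure_integrable_cst N01 1 measurableT) i2.
  by apply: eq_integrable => // x _; rewrite /= EFinD.
by have := integrableZl measurableT C i1; apply: eq_integrable => // x _; rewrite /= EFinM.
Qed.

Lemma qbounded_integrable f : qbounded f ->
  N01.-integrable setT (EFin \o f).
Proof.
move=> [mf [C fC]]; apply: (le_integrable measurableT _ _ (integrable_N01_sqrD1 C)).
- exact/measurable_EFinP.
- by move=> x _; rewrite /= lee_fin (le_trans (fC x))// ler_norm.
Qed.

Lemma gaussE_fineK f : qbounded f ->
  (\int[N01]_x (f x)%:E = (gaussE f)%:E)%E.
Proof.
move=> /qbounded_integrable fi; rewrite /gaussE unlock fineK//.
exact: integrable_fin_num.
Qed.

Lemma qboundedD f g : qbounded f -> qbounded g -> qbounded (fun x => f x + g x).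
Proof.
move=> [mf [C fC]] [mg [D gD]]; split; first exact: measurable_funD.
exists (C + D) => x; rewrite mulrDl (le_trans (ler_normD _ _))// lerD//.
Qed.

Lemma qboundedZ c f : qbounded f -> qbounded (fun x => c * f x).
Proof.
move=> [mf [C fC]]; split; first exact: measurable_funM.
by exists (`|c| * C) => x; rewrite normrM -mulrA ler_wpM2l.
Qed.

Lemma qbounded_cst c : qbounded (fun=> c).
Proof.
split; first exact: measurable_cst.
by exists `|c| => x; rewrite ler_peMr// lerDl sqr_ge0.
Qed.

Lemma qbounded_sqr : qbounded (fun x => x ^+ 2).
Proof.
split; first exact: exprn_measurable.
by exists 1 => x; rewrite mul1r ger0_norm ?sqr_ge0// lerDr.
Qed.

Lemma qbounded_id : qbounded id.
Proof.
split; first exact: measurable_id.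
exists 1 => x; rewrite mul1r -[x ^+ 2]real_normK ?num_real//.
by have := sqr_ge0 (`|x| - 1); have := normr_ge0 x; nra.
Qed.

Lemma qbounded_norm f : qbounded f -> qbounded (fun x => `|f x|).
Proof.
move=> [mf [C fC]]; split; first exact: measurableT_comp.
by exists C => x; rewrite normr_id.
Qed.

Lemma qbounded_le f g : measurable_fun [set: R] f -> qbounded g ->
  (forall x, `|f x| <= g x) -> qbounded f.
Proof.
move=> mf [_ [C gC]] fg; split => //; exists C => x.
by apply: le_trans (fg x) _; apply: le_trans (gC x); exact: ler_norm.
Qed.

Lemma gaussE_cst c : gaussE (fun=> c) = c.
Proof. by rewrite /gaussE (expectation_cst N01 c). Qed.

Lemma gaussED f g : qbounded f -> qbounded g ->
  gaussE (fun x => f x + g x) = gaussE f + gaussE g.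
Proof.
move=> qf qg; apply: EFin_inj; rewrite -gaussE_fineK; last exact: qboundedD.
rewrite EFinD -!gaussE_fineK// -integralD//; exact: qbounded_integrable.
Qed.

Lemma gaussEZ c f : qbounded f -> gaussE (fun x => c * f x) = c * gaussE f.
Proof.
move=> qf; apply: EFin_inj; rewrite -gaussE_fineK; last exact: qboundedZ.
by rewrite EFinM -gaussE_fineK// -integralZl//; exact: qbounded_integrable.
Qed.

Lemma gaussE_le f g : qbounded f -> qbounded g -> (forall x, f x <= g x) ->
  gaussE f <= gaussE g.
Proof.
move=> qf qg fg; rewrite -lee_fin -!gaussE_fineK//.
apply: le_integral => //; try exact: qbounded_integrable.
by move=> x _; rewrite lee_fin.
Qed.

Lemma gaussE_ge0 f : (forall x, 0 <= f x) -> 0 <= gaussE f.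
Proof.
by move=> f0; rewrite /gaussE unlock fine_ge0// integral_ge0// => x _; rewrite lee_fin.
Qed.

Lemma gaussE_abs : gaussE (fun x : R => `|x|) = 2 * phi 0.
Proof.
rewrite gaussE_density//.
by rewrite integral_abs_phi.
Qed.

Lemma gaussE_sqr : gaussE (fun x : R => x ^+ 2) = 1.
Proof.
rewrite gaussE_density; [|exact: exprn_measurable|by move=> x; rewrite sqr_ge0].
by rewrite integral_sqr_phi.
Qed.


Lemma lebesgue_integralN (f : R -> \bar R) : measurable_fun [set: R] f ->
  (forall x, 0 <= f x)%E -> (\int[mu]_x f (- x)%R = \int[mu]_x f x)%E.
Proof.
move=> mf f0; pose opp := (-%R : measurableTypeR R -> measurableTypeR R).
have mopp : measurable_fun setT opp by exact: (@oppr_measurable R setT).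
transitivity (\int[pushforward mu opp]_x f x)%E.
  by rewrite (ge0_integral_pushforward mopp)//.
by apply: eq_measure_integral => A mA _; exact: lebesgue_measureN.
Qed.

Lemma lebesgue_integralDr (f : R -> \bar R) c : measurable_fun [set: R] f ->
  (forall x, 0 <= f x)%E -> (\int[mu]_x f (x + c)%R = \int[mu]_x f x)%E.
Proof.
move=> mf f0; pose tr := (fun x => x + c : measurableTypeR R).
have mtr : @measurable_fun _ _ (measurableTypeR R) (measurableTypeR R) setT tr.
  exact: (measurable_funD (@measurable_id _ (measurableTypeR R) _) (measurable_cst _)).
transitivity (\int[pushforward mu tr]_x f x)%E.
  by rewrite (ge0_integral_pushforward mtr)//.
apply: eq_measure_integral => A mA _; apply/esym.
apply: lebesgue_measure_unique => //= _ [[a b]] _ <-.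
rewrite /pushforward.
have -> : tr @^-1` `]a, b] = `]a - c, b - c]%classic.
  by apply/seteqP; split => x /=; rewrite !in_itv/= /tr ltrBlDr lerBrDr.
rewrite !lebesgue_measure_itv/= !lte_fin ltrD2r; case: ifPn => // _.
by rewrite -!EFinB; congr _%:E; ring.
Qed.

Lemma gaussEN f : qbounded f -> gaussE (fun x => f (- x)) = gaussE f.
Proof.
move=> qf; have [mf [C fC]] := qf.
(* The quadratic bound of f is added to reach the nonnegative case. *)
have ge0N g : measurable_fun [set: R] g -> (forall x, 0 <= g x) ->
    gaussE (fun x => g (- x)) = gaussE g.
  move=> mg g0; rewrite !gaussE_density//; last first.
    exact: measurableT_comp (@oppr_measurable R setT).
  rewrite -[in RHS]lebesgue_integralN; last 2 first.
  - by apply/measurable_EFinP/measurable_funM => //; exact: measurable_phi.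
  - by move=> x; rewrite lee_fin mulr_ge0 ?phi_ge0.
  by under [in RHS]eq_integral do rewrite phiN.
have qC : qbounded (fun x => C * (1 + x ^+ 2)).
  by apply/qboundedZ/qboundedD; [exact: qbounded_cst|exact: qbounded_sqr].
have qN : qbounded (fun x => f (- x)).
  split; first exact: measurableT_comp (@oppr_measurable R setT).
  by exists C => x; rewrite (le_trans (fC _))// sqrrN.
have := ge0N (fun x => f x + C * (1 + x ^+ 2)) (qboundedD qf qC).1.
have f0 x : 0 <= f x + C * (1 + x ^+ 2).
  by have := fC x; have := ler_norm (- f x); rewrite normrN; lra.
move=> /(_ f0).
rewrite (_ : (fun x => _) = fun x => f (- x) + C * (1 + x ^+ 2)); last first.
  by apply/funext => x; rewrite sqrrN.
by rewrite !gaussED// => /addIr.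
Qed.

Lemma gaussE_id : gaussE (fun x : R => x) = 0.
Proof.
have := gaussEN qbounded_id.
have -> : (fun x : R => id (- x)) = (fun x => -1 * x).
  by apply/funext => x; rewrite mulN1r.
by rewrite gaussEZ; [lra|exact: qbounded_id].
Qed.

(** The half-line ]-oo, -1] has positive Gaussian mass. *)
Lemma gaussE_gt0 f : qbounded f -> (forall x, 0 <= f x) ->
  (forall x, x <= -1 -> 0 < f x) -> 0 < gaussE f.
Proof.
move=> qf f0 fpos; rewrite lt_neqAle gaussE_ge0// andbT eq_sym; apply/negP => /eqP.
rewrite (gaussE_density (proj1 qf) f0) => I0.
have mfp : measurable_fun [set: R] (fun x => (f x * phi x)%:E).
  by apply/measurable_EFinP/measurable_funM; [exact: qf.1|exact: measurable_phi].
have {I0} : (\int[mu]_x `|(f x * phi x)%:E| = 0)%E.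
  under eq_integral do rewrite /= ger0_norm ?mulr_ge0 ?phi_ge0//.
  rewrite -[LHS]fineK; first by rewrite I0.
  have mf : measurable_fun [set: R] (EFin \o f) by apply/measurable_EFinP; exact: (proj1 qf).
  have := gaussE_fineK qf.
  rewrite (@integral_N01 _ (EFin \o f))//.
  by move=> ->.
move/(ae_eq_integral_abs mu measurableT mfp) => -[A [mA A0 sub]].
pose J : set R := `[-2, -1]%classic.
have : (mu J <= mu A)%E.
  apply: le_measure; rewrite ?inE//.
    exact: measurable_itv.
  rewrite /J => x /=; rewrite in_itv/= => /andP[_ x1]; apply: sub => /= /(_ I)[].
  by apply/eqP; rewrite gt_eqF// mulr_gt0 ?phi_gt0 ?fpos.
have lt21 : (-2 < -1 :> R) by lra.
by rewrite A0 /J lebesgue_measure_itv/= lte_fin lt21 -EFinB lee_fin; lra.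
Qed.

End GaussianExpectation.

(** * Gaussian integration by parts for the hyperbolic tangent *)

Section HyperbolicTangent.
Context {R : realType}.
Implicit Types (a x : R).

Local Notation mu := (@lebesgue_measure R).

Lemma tanhN x : tanh (- x) = - tanh x.
Proof. by rewrite /tanh opprK -mulNr opprB [in X in _ / X]addrC. Qed.

Lemma expRDN_gt0 x : 0 < expR x + expR (- x).
Proof. by rewrite addr_gt0 ?expR_gt0. Qed.

Lemma tanh_le1 x : tanh x <= 1.
Proof.
rewrite /tanh ler_pdivrMr ?expRDN_gt0// mul1r.
by have := expR_gt0 (- x); lra.
Qed.

Lemma onem_tanh_gt0 x : 0 < 1 - tanh x.
Proof.
rewrite subr_gt0 /tanh ltr_pdivrMr ?expRDN_gt0// mul1r.
by have := expR_gt0 (- x); lra.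
Qed.

Lemma ger0_tanh x : 0 <= x -> 0 <= tanh x.
Proof.
move=> x0; apply: divr_ge0; last exact/ltW/expRDN_gt0.
by rewrite subr_ge0 ler_expR; lra.
Qed.

Lemma norm_tanh_le1 x : `|tanh x| <= 1.
Proof. by rewrite ler_norml tanh_le1 andbT -lerN2 opprK -tanhN tanh_le1. Qed.

Lemma is_derive_tanh x : is_derive x 1 (@tanh R) (1 - tanh x ^+ 2).
Proof.
have h := expRDN_gt0 x.
have h0 : expR x + expR (- x) != 0 by rewrite gt_eqF.
rewrite /tanh; apply: is_derive_eq; rewrite /GRing.scale/=.
by field; rewrite h0.
Qed.

Lemma ler_tanh : {homo @tanh R : x y / x <= y}.
Proof.
move=> x y xy.
rewrite /tanh ler_pdivrMr ?expRDN_gt0// mulrAC ler_pdivlMr ?expRDN_gt0//.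
have := expR_gt0 (- x); have := expR_gt0 (- y).
have : expR x <= expR y by rewrite ler_expR.
have : expR (- y) <= expR (- x) by rewrite ler_expR lerN2.
have := expR_gt0 x; nra.
Qed.

Lemma continuous_tanh : continuous (@tanh R).
Proof. by move=> x; exact: is_derive_continuous (is_derive_tanh x). Qed.

Lemma continuous_tanhZ a : continuous (fun x => tanh (a * x)).
Proof.
move=> x; apply: continuous_comp; last exact: continuous_tanh.
exact: mulrl_continuous.
Qed.

Lemma qbounded_mul_tanh a : qbounded (fun x => x * tanh (a * x)).
Proof.
apply: (qbounded_le _ (qbounded_norm qbounded_id)).
- apply: measurable_funM => //.
  by apply: continuous_measurable_fun; exact: continuous_tanhZ.
- by move=> x; rewrite normrM ler_piMr// norm_tanh_le1.
Qed.

Lemma qbounded_sqr_tanh a : qbounded (fun x => tanh (a * x) ^+ 2).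
Proof.
apply: (qbounded_le _ (qbounded_cst 1)).
- by apply: measurable_funX; apply: continuous_measurable_fun; exact: continuous_tanhZ.
- by move=> x; rewrite normrX exprn_ile1// norm_tanh_le1.
Qed.

Lemma mul_tanh_norm a x : 0 <= a -> x * tanh (a * x) = `|x| * tanh (a * `|x|).
Proof.
move=> a0; have [x0|x0] := ger0P x => //.
by rewrite mulrN tanhN mulrNN.
Qed.

Lemma mul_tanh_ge0 a x : 0 <= a -> 0 <= x * tanh (a * x).
Proof. by move=> a0; rewrite mul_tanh_norm// mulr_ge0// ger0_tanh// mulr_ge0. Qed.

(** Integration by parts, E[Z h(Z)] = E[h'(Z)], for h(z) = tanh (a z). The two
    expectations are combined into that of a nonnegative even function,
    x tanh (a x) + a tanh (a x)^2, which times phi has the antiderivative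
    a Phi(x) - phi(x) tanh (a x). *)
Lemma gaussE_mul_tanh a : 0 <= a ->
  gaussE (fun x => x * tanh (a * x)) =
  a * (1 - gaussE (fun x => tanh (a * x) ^+ 2)).
Proof.
move=> a0.
suff : gaussE (fun x => x * tanh (a * x) + a * tanh (a * x) ^+ 2) = a.
  have q1 := qbounded_mul_tanh a; have q2 := qbounded_sqr_tanh a.
  by rewrite gaussED//; [rewrite gaussEZ//; lra|exact: qboundedZ].
set f := (X in gaussE X).
have f0 x : 0 <= f x by rewrite addr_ge0 ?mul_tanh_ge0// mulr_ge0 ?sqr_ge0.
have cf : continuous f.
  have ct := @continuous_tanhZ a.
  move=> x; apply: cvgD; apply: cvgM; [exact: cvg_id|exact: ct|exact: cvg_cst|].
  by rewrite expr2; apply: cvgM; exact: ct.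
rewrite gaussE_density//; last exact: continuous_measurable_fun.
pose F x := a * Phi x - phi x * tanh (a * x).
have dF x : is_derive x 1 F (f x * phi x).
  have d1 := is_derive_Phi x; have d2 := is_derive_phi x.
  have d3 : is_derive x 1 (fun x => tanh (a * x)) (a * (1 - tanh (a * x) ^+ 2)).
    have dt := is_derive_tanh (a * x).
    have di : is_derive x 1 (fun x : R => a * x) a.
      by apply: is_derive_eq; rewrite /GRing.scale/= mulr1.
    apply: (is_derive_eq (@is_derive1_comp _ (@tanh R) (fun x => a * x) x _ _ dt di)).
    by rewrite mulrC.
  by apply: is_derive_eq; rewrite /f /GRing.scale/=; ring.
have -> : (\int[mu]_x (f x * phi x)%:E = (2 * (a - F 0))%:E)%E; last first.
  by rewrite /F Phi0 mulr0 /tanh oppr0 subrr mul0r mulr0/=; lra.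
apply: (@even_FTC2 _ _ F a).
- by move=> x; rewrite mulr_ge0 ?phi_ge0.
- by move=> x; apply: continuousM; [exact: cf|exact: continuous_phi].
- by move=> x; rewrite phiN /f !mulrN !tanhN mulrNN sqrrN.
- exact: is_derive_continuous (dF 0).
- rewrite -[X in _ --> X]subr0 /F; apply: cvgB.
    by rewrite -[X in _ --> X]mulr1; apply: cvgM; [exact: cvg_cst|exact: cvg_Phi].
  apply: norm_cvg0.
  apply: (squeeze_cvgr _ (cvg_cst 0) cvg_phi); near=> x.
  by rewrite normr_ge0/= normrM ger0_norm ?phi_ge0// ler_piMr ?phi_ge0// norm_tanh_le1.
Unshelve. all: by end_near. Qed.

Lemma onem_P_tanh (r : R) : 0 <= r ->
  Num.sqrt r * (1 - P r) = gaussE (fun z => z * tanh (Num.sqrt r * z)).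
Proof. by move=> r0; rewrite gaussE_mul_tanh ?sqrtr_ge0. Qed.

Lemma gaussE_mul_tanh_mono a b : 0 <= a -> a <= b ->
  gaussE (fun x => x * tanh (a * x)) <= gaussE (fun x => x * tanh (b * x)).
Proof.
move=> a0 ab; apply: gaussE_le; [exact: qbounded_mul_tanh..|move=> x].
rewrite (mul_tanh_norm x a0) (mul_tanh_norm x (le_trans a0 ab)).
rewrite ler_wpM2l// ler_tanh//.
by rewrite ler_wpM2r.
Qed.

(** The bound is E|Z|. Its strictness is what keeps alpha away from alpha_c as
    long as r is bounded. *)
Lemma gaussE_mul_tanh_lt a : 0 <= a ->
  gaussE (fun x => x * tanh (a * x)) < 2 * phi 0.
Proof.
move=> a0; rewrite -gaussE_abs -subr_gt0.
have q1 := qbounded_mul_tanh a; have q2 := qbounded_norm (@qbounded_id R).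
have q3 := qboundedZ (-1) q1.
suff : 0 < gaussE (fun x => `|x| + -1 * (x * tanh (a * x))).
  by rewrite gaussED// gaussEZ// mulN1r.
have E x : `|x| + -1 * (x * tanh (a * x)) = `|x| * (1 - tanh (a * `|x|)).
  by rewrite mul_tanh_norm//; ring.
apply: gaussE_gt0; first exact: qboundedD.
- by move=> x; rewrite E mulr_ge0// ltW// onem_tanh_gt0.
- move=> x x1; rewrite E mulr_gt0 ?onem_tanh_gt0// normr_gt0.
  by apply/eqP; lra.
Qed.

End HyperbolicTangent.

(** * Bounds on the inverse Mills ratio *)

Section MillsRatio.
Context {R : realType}.
Implicit Types (a x u : R).

(** The comparison principle behind the bounds on the Mills ratio: Phibar and
    the multiples of phi to which it is compared all vanish at infinity, so
    the sign of their difference is read off its derivative. *)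
Lemma nonincreasing_to0_ge0 (g g' : R -> R) a :
  (forall x, a <= x -> is_derive x 1 g (g' x)) ->
  (forall x, a <= x -> g' x <= 0) ->
  g x @[x --> +oo%R] --> (0 : R) -> 0 <= g a.
Proof.
move=> dg g'0 gl.
have mono y : a <= y -> g y <= g a.
  move=> ay; apply: (@ler0_derive1_nincry _ g a) => //.
  - by move=> x; rewrite in_itv/= andbT => /ltW ax; have [] := dg _ ax.
  - move=> x; rewrite in_itv/= andbT => /ltW ax.
    by rewrite derive1E; have dgx := dg _ ax; rewrite derive_val g'0.
  - apply: continuous_in_subspaceT => x; rewrite inE/= in_itv/= andbT => ax.
    exact: is_derive_continuous (dg _ ax).
apply: (cvgr_to_le gl); near=> y; apply: mono.
by near: y; apply: nbhs_pinfty_ge; rewrite num_real.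
Unshelve. all: by end_near. Qed.

Lemma is_derive_Phibar u : is_derive u 1 (@Phibar R) (- phi u).
Proof.
have d := is_derive_Phi u.
by rewrite /Phibar; apply: is_derive_eq; rewrite add0r mul1r.
Qed.

Lemma cvg_Phibar : Phibar x @[x --> +oo%R] --> (0 : R).
Proof. by rewrite -(subrr 1); apply: cvgB; [exact: cvg_cst|exact: cvg_Phi]. Qed.

Lemma ler_of_sqr (x y : R) : 0 <= y -> x ^+ 2 <= y ^+ 2 -> x <= y.
Proof. by move=> y0 xy; rewrite leNgt; apply/negP => yx; nra. Qed.

Lemma sqr_addr_gt0 c u : 0 < c -> 0 < u ^+ 2 + c.
Proof. by move=> c0; rewrite ltr_wpDl ?sqr_ge0. Qed.

Lemma is_derive_sqrt_sqr c u : 0 < c ->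
  is_derive u 1 (fun x => Num.sqrt (x ^+ 2 + c)) (u / Num.sqrt (u ^+ 2 + c)).
Proof.
move=> c0; have h := sqr_addr_gt0 u c0.
have ds := is_derive1_sqrt h.
have dq : is_derive u 1 (fun x : R => x ^+ 2 + c) (2 * u).
  by apply: is_derive_eq; rewrite /GRing.scale/=; ring.
apply: (is_derive_eq (@is_derive1_comp _ (@Num.sqrt R) (fun x => x ^+ 2 + c) u _ _ ds dq)).
by field; rewrite sqrtr_eq0 -ltNge.
Qed.

(** With s = sqrt (x^2 + 2), the difference has derivative
    phi (x / s + x / s^3 - 1), which is nonpositive because s^6 - x^2
    (x^2 + 3)^2 = 3 x^2 + 8. *)
Lemma Phibar_ge u : phi u / Num.sqrt (u ^+ 2 + 2) <= Phibar u.
Proof.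
pose s x : R := Num.sqrt (x ^+ 2 + 2).
have s0 x : 0 < s x by rewrite sqrtr_gt0 sqr_addr_gt0.
have s2 x : s x ^+ 2 = x ^+ 2 + 2 by rewrite sqr_sqrtr// ltW// sqr_addr_gt0.
rewrite -subr_ge0 -/(s u).
apply: (@nonincreasing_to0_ge0 (fun x => Phibar x - phi x / s x)
  (fun x => phi x * (x / s x + x / s x ^+ 3 - 1))).
- move=> x _; have d1 := is_derive_Phibar x; have d2 := is_derive_phi x.
  have sn0 : s x != 0 by rewrite gt_eqF.
  have d3 : is_derive x 1 s (x / s x) by exact: is_derive_sqrt_sqr.
  have d4 : is_derive x 1 (fun x => (s x)^-1) (- s x ^- 2 *: (x / s x)).
    exact: is_deriveV.
  apply: is_derive_eq; rewrite /GRing.scale/=; field; exact: sn0.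
- move=> x _; rewrite mulr_ge0_le0 ?phi_ge0// subr_le0.
  have -> : x / s x + x / s x ^+ 3 = x * (x ^+ 2 + 3) / (s x ^+ 3).
    have -> : x ^+ 2 + 3 = s x ^+ 2 + 1 by rewrite s2; ring.
    by field; rewrite gt_eqF.
  rewrite ler_pdivrMr ?exprn_gt0// mul1r.
  apply: ler_of_sqr; first by rewrite exprn_ge0// ltW.
  rewrite exprAC s2 -subr_ge0.
  have -> : (x ^+ 2 + 2) ^+ 3 - (x * (x ^+ 2 + 3)) ^+ 2 = 3 * x ^+ 2 + 8 by ring.
  by rewrite addr_ge0// mulr_ge0// sqr_ge0.
- rewrite -[X in _ --> X]subr0; apply: cvgB; first exact: cvg_Phibar.
  apply: (squeeze_cvgr _ (cvg_cst 0) (@cvg_phi R)); near=> x.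
  rewrite divr_ge0 ?phi_ge0 ?(ltW (s0 _))//= ler_pdivrMr//.
  rewrite ler_peMr ?phi_ge0// -[leLHS]sqrtr1 ler_sqrt ?ltW ?sqr_addr_gt0//.
  by have := sqr_ge0 x; lra.
Unshelve. all: by end_near. Qed.

Lemma Phibar_gt0 u : 0 < Phibar u.
Proof.
apply: lt_le_trans (Phibar_ge u).
by rewrite divr_gt0 ?phi_gt0// sqrtr_gt0 sqr_addr_gt0.
Qed.

Lemma invMills_gt0 u : 0 < invMills u.
Proof. by rewrite divr_gt0 ?phi_gt0 ?Phibar_gt0. Qed.

Lemma invMills_sqr_le u : invMills u ^+ 2 <= u ^+ 2 + 2.
Proof.
have h := sqr_addr_gt0 u (ltr0n R 2).
rewrite -[leRHS]sqr_sqrtr ?(ltW h)// lerXn2r ?nnegrE ?sqrtr_ge0 ?(ltW (invMills_gt0 _))//.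
by rewrite ler_pdivrMr ?Phibar_gt0// mulrC -ler_pdivrMr ?sqrtr_gt0// Phibar_ge.
Qed.

(** The larger root b of 2 b^2 - 3 u b + u^2 = 1. *)
Definition sampford u : R := (3 * u + Num.sqrt (u ^+ 2 + 8)) / 4.

Lemma sampford_gt0 u : -1 < u -> 0 < sampford u.
Proof.
move=> u1; rewrite divr_gt0//.
have [u0|u0] := leP 0 u.
  by rewrite ltr_wpDl ?mulr_ge0// sqrtr_gt0 sqr_addr_gt0.
suff : - (3 * u) < Num.sqrt (u ^+ 2 + 8) by lra.
rewrite ltNge; apply/negP => h.
have := sqr_sqrtr (ltW (sqr_addr_gt0 u (ltr0n R 8))).
by have := sqrtr_ge0 (u ^+ 2 + 8); nra.
Qed.

(** With b = sampford and s = sqrt (x^2 + 8), the derivative of phi / b - Phibar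
    is nonpositive if x (x^2 + 6) <= (x^2 + 2) s, where the square of the
    right side exceeds that of the left one by 32. The condition on u makes
    b positive on the whole half-line. *)
Lemma invMills_ge_sampford u : -1 < u -> sampford u <= invMills u.
Proof.
move=> u1.
pose s x : R := Num.sqrt (x ^+ 2 + 8).
have s0 x : 0 < s x by rewrite sqrtr_gt0 sqr_addr_gt0.
have s2 x : s x ^+ 2 = x ^+ 2 + 8 by rewrite sqr_sqrtr// ltW// sqr_addr_gt0.
rewrite ler_pdivlMr ?Phibar_gt0// mulrC -ler_pdivlMr ?sampford_gt0// -subr_ge0.
apply: (@nonincreasing_to0_ge0 (fun x => phi x / sampford x - Phibar x)
  (fun x => phi x * (1 - x / sampford x - (3 + x / s x) / 4 / sampford x ^+ 2))).
- move=> x ux; have d1 := is_derive_Phibar x; have d2 := is_derive_phi x.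
  have sn0 : s x != 0 by rewrite gt_eqF.
  have b0 : sampford x != 0 by rewrite gt_eqF// sampford_gt0// (lt_le_trans u1).
  have d3 : is_derive x 1 s (x / s x) by exact: is_derive_sqrt_sqr.
  have d4 : is_derive x 1 sampford ((3 + x / s x) / 4).
    rewrite /sampford -/s; apply: is_derive_eq; rewrite /GRing.scale/=.
    by field; exact: sn0.
  have d5 : is_derive x 1 (fun x => (sampford x)^-1)
    (- sampford x ^- 2 *: ((3 + x / s x) / 4)) by exact: is_deriveV.
  apply: is_derive_eq; rewrite /GRing.scale/=; field; by rewrite sn0 b0.
- move=> x ux; have x1 := lt_le_trans u1 ux.
  rewrite mulr_ge0_le0 ?phi_ge0//.
  have b0 := sampford_gt0 x1.
  have -> : 1 - x / sampford x - (3 + x / s x) / 4 / sampford x ^+ 2 =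
    (sampford x ^+ 2 - x * sampford x - (3 + x / s x) / 4) / sampford x ^+ 2.
    by field; rewrite !gt_eqF.
  rewrite mulr_le0_ge0 ?invr_ge0 ?exprn_ge0 ?(ltW b0)//.
  rewrite /sampford -/(s x).
  have -> : ((3 * x + s x) / 4) ^+ 2 - x * ((3 * x + s x) / 4) - (3 + x / s x) / 4
    = (x * (x ^+ 2 + 6) - (x ^+ 2 + 2) * s x) / (8 * s x).
    by field: (s2 x); rewrite gt_eqF.
  rewrite ler_pdivrMr ?mulr_gt0// mul0r subr_le0.
  apply: ler_of_sqr.
    by rewrite mulr_ge0 ?(ltW (s0 _))// addr_ge0 ?sqr_ge0.
  rewrite [leRHS]exprMn s2 -subr_ge0.
  have -> : (x ^+ 2 + 2) ^+ 2 * (x ^+ 2 + 8) - (x * (x ^+ 2 + 6)) ^+ 2 = 32 by ring.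
  by [].
- rewrite -[X in _ --> X]subr0; apply: cvgB; last exact: cvg_Phibar.
  have p2 : 2 * phi x @[x --> +oo%R] --> (0 : R).
    by rewrite -(mulr0 2); apply: cvgM; [exact: cvg_cst|exact: cvg_phi].
  apply: (squeeze_cvgr _ (cvg_cst 0) p2); near=> x.
  have x0 : 0 <= x by near: x; apply: nbhs_pinfty_ge; rewrite num_real.
  have b0 : 0 < sampford x by rewrite sampford_gt0//; lra.
  rewrite divr_ge0 ?phi_ge0 ?(ltW b0)//= ler_pdivrMr// mulrAC ler_peMl ?phi_ge0//.
  have s28 : 2 <= s x.
    apply: ler_of_sqr; rewrite ?(ltW (s0 _))// s2.
    by have := sqr_ge0 x; lra.
  by rewrite /sampford -/(s x); lra.
Unshelve. all: by end_near. Qed.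

End MillsRatio.

Section MillsRatioBounds.
Context {R : realType}.
Implicit Types (a x u : R).

Lemma continuous_invMills : continuous (@invMills R).
Proof.
move=> u; rewrite /invMills; apply: cvgM; first exact: continuous_phi.
apply: cvgV; first by rewrite gt_eqF// Phibar_gt0.
exact: is_derive_continuous (is_derive_Phibar u).
Qed.

(** On the negative half-line phi is at most phi 0 and Phibar at least Phibar 0. *)
Lemma invMills_le0 u : u <= 0 -> invMills u ^+ 2 <= 2.
Proof.
move=> u0; apply: (@le_trans _ _ (invMills 0 ^+ 2)); last first.
  by have := invMills_sqr_le (0 : R); rewrite expr0n/= add0r.
rewrite lerXn2r ?nnegrE ?(ltW (invMills_gt0 _))//.
rewrite ler_pM ?phi_ge0 ?invr_ge0 ?(ltW (Phibar_gt0 _))//.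
- rewrite !phiE ler_wpM2l ?invr_ge0 ?sqrtr_ge0// ler_expR expr0n/=.
  by have := sqr_ge0 u; lra.
- rewrite lef_pV2 ?posrE ?Phibar_gt0//.
  apply: (@ler0_derive1_nincry _ (@Phibar R) u) => //.
  - by move=> x _; have [] := is_derive_Phibar x.
  - move=> x _; rewrite derive1E; have d := is_derive_Phibar x.
    by rewrite derive_val oppr_le0 phi_ge0.
  - apply: continuous_subspaceT => x.
    exact: is_derive_continuous (is_derive_Phibar x).
Qed.

Lemma sampford_sqrt_ge u : 0 <= u -> u <= Num.sqrt (u ^+ 2 + 8).
Proof.
move=> u0; apply: ler_of_sqr; first exact: sqrtr_ge0.
by rewrite sqr_sqrtr ?lerDl// ltW// sqr_addr_gt0.
Qed.

Lemma invMills_ge_id u : 0 <= u -> u <= invMills u.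
Proof.
move=> u0; apply: le_trans (invMills_ge_sampford _); last by lra.
by have := sampford_sqrt_ge u0; rewrite /sampford; lra.
Qed.

Lemma invMills_sqr_ge u : -1 < u ->
  (10 * u ^+ 2 + 8 + 6 * u * Num.sqrt (u ^+ 2 + 8)) / 16 <= invMills u ^+ 2.
Proof.
move=> u1; apply: (@le_trans _ _ (sampford u ^+ 2)); last first.
  rewrite lerXn2r ?nnegrE ?(ltW (invMills_gt0 _)) ?(ltW (sampford_gt0 _))//.
  exact: invMills_ge_sampford.
have := sqr_sqrtr (ltW (sqr_addr_gt0 u (ltr0n R 8))).
by rewrite /sampford; set s := Num.sqrt _ => s2; lra.
Qed.

(** The threshold 1 / 3 is where the square of Sampford's bound reaches 1 + u^2. *)
Lemma invMills_sqr_ge1 u : 0 <= u -> 3^-1 <= u ^+ 2 ->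
  1 + u ^+ 2 <= invMills u ^+ 2.
Proof.
move=> u0 u3; apply: le_trans (invMills_sqr_ge _); last by lra.
have := sqr_sqrtr (ltW (sqr_addr_gt0 u (ltr0n R 8))).
have := sqrtr_ge0 (u ^+ 2 + 8); set s := Num.sqrt _ => s0 s2.
have : 3 * u ^+ 2 + 4 <= 3 * u * s.
  apply: ler_of_sqr; first by rewrite !mulr_ge0.
  by rewrite [leRHS]exprMn s2; nra.
by lra.
Qed.

(** When |u| < 1, the square roots cancel in the sum of the two bounds of
    invMills_sqr_ge, which leaves (20 u^2 + 16) / 16. When |u| >= 1, one of
    the two terms is large enough by itself. *)
Lemma invMills_sqrD u : 1 + u ^+ 2 <= invMills u ^+ 2 + invMills (- u) ^+ 2.
Proof.
wlog u0 : u / 0 <= u.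
  move=> h; have [/h//|u0] := leP 0 u.
  by have := h (- u); rewrite opprK sqrrN (addrC (invMills (- u) ^+ 2)); apply; lra.
have [u1|u1] := leP 1 u.
  apply: (@le_trans _ _ (invMills u ^+ 2)); last by rewrite lerDl sqr_ge0.
  by apply: invMills_sqr_ge1 => //; nra.
have h1 : -1 < u by lra. have h2 : -1 < - u by lra.
have := invMills_sqr_ge h1; have := invMills_sqr_ge h2; rewrite sqrrN.
by have := sqr_ge0 u; lra.
Qed.

Lemma sin_le_id x : 0 <= x -> sin x <= x.
Proof.
move=> x0; rewrite -subr_ge0.
have mono : {in `[0, x] &, {homo (fun y : R => y - sin y) : y z / y <= z}}.
  apply: ger0_derive1_le_cc.
  - by move=> y _; exact: ex_derive.
  - move=> y _; rewrite derive1E.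
    rewrite (_ : 'D_1 _ y = 1 - cos y); last by rewrite derive_val.
    by rewrite subr_ge0 cos_le1.
  - apply: continuous_subspaceT => y; apply: cvgB; first exact: cvg_id.
    exact: continuous_sin.
have := mono 0 x; rewrite sin0 subrr; apply => //.
- by rewrite in_itv/= lexx.
- by rewrite in_itv/= lexx x0.
Qed.

(** By duplication cos (pi / 2) = 0 gives sin (pi / 4)^2 = 1 / 2, and
    sin (pi / 4) <= pi / 4. *)
Lemma pi_sqr_ge8 : 8 <= (pi : R) ^+ 2.
Proof.
have y0 : 0 <= pi / 4 :> R by rewrite divr_ge0// pi_ge0.
have := cos_mulr2n (pi / 4 : R).
rewrite (_ : pi / 4 *+ 2 = pi / 2 :> R); last by rewrite mulr2n; field.
rewrite cos_pihalf cos2sin2 mulr2n => h.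
have s0 : 0 <= sin (pi / 4 : R).
  by apply: sin_ge0_pi; rewrite y0/=; have := @pi_ge0 R; lra.
have := sin_le_id y0; nra.
Qed.

(** The exact value is sqrt (2 / pi) = 0.797...; the region u^2 < 1 / 3 in
    meanHinge_le_invMills tolerates slightly more than 0.842. *)
Lemma two_phi0_le : 2 * phi (0 : R) <= 842 / 1000.
Proof.
have := @phi0_sqr R; have := @pi_gt0 R; have := phi_gt0 (0 : R).
have := pi_sqr_ge8; move: (phi 0) (pi : R) => p q q8 p0 q0 pq.
have {}pq : 2 * q * p ^+ 2 = 1 by rewrite pq mulfV// mulf_neq0// gt_eqF.
rewrite leNgt; apply/negP => h.
have q28 : 2828 / 1000 < q by nra.
nra.
Qed.

End MillsRatioBounds.

(** * Rotation invariance *)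

Section GaussianRotation.
Context {R : realType}.
Implicit Types (f : R -> R) (a b x y z : R).

Local Notation mu := (@lebesgue_measure R).
Local Notation N01 := (normal_prob (0 : R) (1 : R)).

Lemma gaussE_lebesgue f : qbounded f -> (forall x, 0 <= f x) ->
  (\int[mu]_x (f x * phi x)%:E = (gaussE f)%:E)%E.
Proof.
move=> qf f0; rewrite -gaussE_fineK// (@integral_N01 _ (EFin \o f))//.
by apply/measurable_EFinP; exact: (proj1 qf).
Qed.

Lemma qbounded_affine f a b : qbounded f -> qbounded (fun x => f (a * x + b)).
Proof.
move=> [mf [C fC]]; split.
  apply: measurableT_comp => //; apply: continuous_measurable_fun => x.
  by apply: cvgD; [exact: mulrl_continuous|exact: cvg_cst].
exists (C * (1 + 2 * a ^+ 2 + 2 * b ^+ 2)) => x.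
apply: le_trans (fC _) _.
have C0 : 0 <= C.
  have := le_trans (normr_ge0 _) (fC 0).
  by rewrite expr0n/= addr0 mulr1.
rewrite -mulrA ler_wpM2l//.
have := sqr_ge0 (a * x - b); have := sqr_ge0 b; have := sqr_ge0 a; have := sqr_ge0 x.
have := sqr_ge0 (a * x); have := sqr_ge0 (b * x).
by rewrite !exprMn; nra.
Qed.

(** Both sides are the mean of f under the law of c + b G. *)
Lemma integral_gauss_affine f c b : (forall x, 0 <= f x) -> continuous f -> 0 < b ->
  (\int[mu]_g (f (c + b * g) * phi g)%:E =
   \int[mu]_y (f y * (phi ((y - c) / b) / b))%:E)%E.
Proof.
move=> f0 cf b0.
pose F y := (y - c) / b; pose G g := f (c + b * g) * phi g.
have dF x : is_derive x 1 F b^-1.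
  by apply: is_derive_eq; rewrite /GRing.scale/=; ring.
have F'E : F^`()%classic = cst b^-1.
  by apply/funext => x; rewrite derive1E derive_val.
rewrite (@increasing_ge0_integration_by_substitutionT _ F G).
- apply: eq_integral => y _; rewrite F'E; congr _%:E.
  change (f (c + b * F y) * phi (F y) * b^-1 = f y * (phi (F y) / b)).
  have -> : c + b * F y = y by rewrite /F; field; rewrite gt_eqF.
  by rewrite mulrA.
- by move=> x y xy; rewrite /F ltr_pM2r ?invr_gt0// ltrD2r.
- by rewrite F'E => x; exact: cvg_cst.
- by rewrite F'E; exact: is_cvg_cst.
- by rewrite F'E; exact: is_cvg_cst.
- by move=> x; have [] := dF x.
- apply/gt0_cvgMlNy; first by rewrite invr_gt0.
  exact: cvg_addrr_Ny.
- apply/gt0_cvgMly; first by rewrite invr_gt0.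
  exact: cvg_addrr.
- move=> x; apply: cvgM; last exact: continuous_phi.
  apply: (@continuous_comp _ _ _ (fun g => c + b * g) f); last exact: cf.
  by apply: cvgD; [exact: cvg_cst|exact: mulrl_continuous].
- by move=> x; rewrite mulr_ge0 ?phi_ge0.
Qed.

(** Both exponents are - (y^2 - 2 a y z + z^2) / (2 b^2). *)
Lemma phi_rotation a b y z : b != 0 -> a ^+ 2 + b ^+ 2 = 1 ->
  phi ((y - a * z) / b) * phi z = phi ((z - a * y) / b) * phi y.
Proof.
move=> b0 ab; rewrite !phiE ![_ * expR _ * (_ * expR _)]mulrACA -!expRD.
congr (_ * expR _).
have e : (y - a * z) ^+ 2 = (z - a * y) ^+ 2 + (y ^+ 2 - z ^+ 2) * b ^+ 2.
  have -> : b ^+ 2 = 1 - a ^+ 2 by rewrite -ab; ring.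
  by ring.
by rewrite !expr_div_n e; field.
Qed.

(** In the variable y = a z + b g the joint density factors as phi(y) times the
    density of a normal law in z centred at a y, which integrates to 1; the
    integrals over y and z are exchanged by Tonelli's theorem. *)
Lemma gaussE_rotation f a b : (forall x, 0 <= f x) -> continuous f -> qbounded f ->
  0 < b -> a ^+ 2 + b ^+ 2 = 1 ->
  gaussE (fun z => gaussE (fun g => f (a * z + b * g))) = gaussE f.
Proof.
move=> f0 cf qf b0 ab; have bn0 : b != 0 by rewrite gt_eqF.
pose k (w : R * R) : \bar R := (f w.2 * (phi ((w.2 - a * w.1) / b) / b))%:E.
have mphi2 : measurable_fun setT (fun w : R * R => phi ((w.2 - a * w.1) / b)).
  apply: (measurableT_comp (@measurable_phi R)).
  apply: measurable_funM => //; apply: measurable_funB; first exact: measurable_snd.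
  by apply: measurable_funM => //; exact: measurable_fst.
have mk : measurable_fun setT k.
  apply/measurable_EFinP; apply: measurable_funM.
    exact: (measurableT_comp (proj1 qf) measurable_snd).
  exact: measurable_funM.
have k0 w : (0 <= k w)%E by rewrite lee_fin mulr_ge0// divr_ge0 ?phi_ge0// ltW.
have inner z : ((gaussE (fun g => f (a * z + b * g)))%:E = \int[mu]_y k (z, y))%E.
  rewrite -gaussE_lebesgue//; last first.
    have := qbounded_affine b (a * z) qf.
    by congr qbounded; apply/funext => x; rewrite addrC.
  exact: integral_gauss_affine.
pose h z := gaussE (fun g => f (a * z + b * g)).
rewrite -/h /gaussE unlock.
have -> : (\int[N01]_z (h z)%:E = \int[N01]_z \int[mu]_y k (z, y))%E.
  by apply: eq_integral => z _; rewrite inner.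
rewrite integral_N01; last 2 first.
- by apply: (measurable_fun_fubini_tonelli_F (m2:=mu) k); [exact: mk|exact: k0].
- by move=> z; apply: integral_ge0 => y _; exact: k0.
transitivity (fine (\int[mu]_z \int[mu]_y (k (z, y) * (phi z)%:E)))%E.
  congr fine; apply: eq_integral => z _.
  rewrite ge0_integralZr//; first exact: (measurableT_comp mk (@measurable_pair1 _ _ _ _ z)).
  by rewrite lee_fin phi_ge0.
pose k2 (w : R * R) : \bar R := (k w * (phi w.1)%:E)%E.
rewrite (@fubini_tonelli _ _ _ _ _ mu mu k2); last 2 first.
- apply: emeasurable_funM => //; apply/measurable_EFinP.
  exact: (measurableT_comp (@measurable_phi R) measurable_fst).
- by move=> w; rewrite mule_ge0// lee_fin phi_ge0.
rewrite (@integral_N01 _ (EFin \o f))//; last by apply/measurable_EFinP; exact: (proj1 qf).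
congr fine; apply: eq_integral => y _.
have one : (\int[mu]_z (phi ((z - a * y) / b) / b)%:E = 1)%E.
  have := @integral_gauss_affine (fun=> 1) (a * y) b (fun=> ler01)
    (fun x => cvg_cst _) b0.
  under eq_integral do rewrite mul1r; rewrite integral_normal_pdf => ->.
  by under [RHS]eq_integral do rewrite mul1r.
transitivity (\int[mu]_z ((f y * phi y)%:E * (phi ((z - a * y) / b) / b)%:E))%E.
  apply: eq_integral => z _; rewrite /k2 /k /= -!EFinM; congr _%:E.
  have := phi_rotation y z bn0 ab => rot.
  transitivity (f y * b^-1 * (phi ((y - a * z) / b) * phi z)); first by ring.
  by rewrite rot; ring.
rewrite ge0_integralZl//.
- by rewrite one mule1 EFinM.
- apply/measurable_EFinP; apply: measurable_funM => //.
  apply: (measurableT_comp (@measurable_phi R)).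
  by apply: measurable_funM => //; apply: measurable_funB.
- by move=> z _; rewrite lee_fin mulr_ge0 ?phi_ge0// invr_ge0 ltW.
- by rewrite lee_fin mulr_ge0 ?phi_ge0.
Qed.

End GaussianRotation.

(** * The mean squared hinge *)

Section Hinge.
Context {R : realType}.
Implicit Types (f : R -> R) (a b x y z u v w m s g : R).

Local Notation mu := (@lebesgue_measure R).

Definition hinge x : R := Num.max x 0 ^+ 2.

Lemma hinge_ge0 x : 0 <= hinge x.
Proof. exact: sqr_ge0. Qed.

Lemma hinge_pos x : 0 <= x -> hinge x = x ^+ 2.
Proof. by move=> x0; rewrite /hinge max_l. Qed.

Lemma hinge_neg x : x <= 0 -> hinge x = 0.
Proof. by move=> x0; rewrite /hinge max_r// expr0n. Qed.

Lemma hinge_le_sqr x : hinge x <= x ^+ 2.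
Proof.
by have [x0|/ltW x0] := leP 0 x; rewrite ?(hinge_pos x0)// hinge_neg// sqr_ge0.
Qed.

Lemma hingeDN x : hinge x + hinge (- x) = x ^+ 2.
Proof.
have [x0|/ltW x0] := leP 0 x.
  by rewrite hinge_pos// hinge_neg ?addr0// oppr_le0.
by rewrite hinge_neg// add0r hinge_pos ?sqrrN// oppr_ge0.
Qed.

Lemma hingeZ b x : 0 <= b -> hinge (b * x) = b ^+ 2 * hinge x.
Proof. by move=> b0; rewrite /hinge -[in LHS](mulr0 b) -maxr_pMr// exprMn. Qed.

Lemma ler_hinge x y : x <= y -> hinge x <= hinge y.
Proof.
move=> xy; have [/ltW x0|x0] := ltP x 0; first by rewrite hinge_neg ?hinge_ge0.
by rewrite !hinge_pos ?(le_trans x0)// lerXn2r ?nnegrE ?(le_trans x0).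
Qed.

Lemma continuous_hinge : continuous hinge.
Proof.
move=> x; have -> : hinge = fun x => ((x + `|x|) / 2) ^+ 2.
  apply/funext => y; have [y0|y0] := ger0P y.
    by rewrite hinge_pos//; congr (_ ^+ 2); lra.
  by rewrite hinge_neg ?ltW// subrr mul0r expr0n.
have h : {for x, continuous (fun x : R => (x + `|x|) / 2)}.
  apply: cvgM; last exact: cvg_cst.
  by apply: cvgD; [exact: cvg_id|exact: norm_continuous].
apply: (@continuous_comp _ _ _ (fun x => (x + `|x|) / 2) (fun x => x ^+ 2)) => //.
exact: exprn_continuous.
Qed.

Lemma qbounded_hinge : qbounded hinge.
Proof.
apply: (qbounded_le _ qbounded_sqr).
  exact: continuous_measurable_fun continuous_hinge.
by move=> x; rewrite ger0_norm ?hinge_ge0// hinge_le_sqr.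
Qed.

Lemma qbounded_hingeB u : qbounded (fun g => hinge (u - g)).
Proof.
have := qbounded_affine (-1) u qbounded_hinge.
by congr qbounded; apply/funext => g; rewrite mulN1r addrC.
Qed.

Lemma qbounded_hingeD u : qbounded (fun g => hinge (u + g)).
Proof.
have := qbounded_affine 1 u qbounded_hinge.
by congr qbounded; apply/funext => g; rewrite mul1r addrC.
Qed.

Definition meanHinge u : R := gaussE (fun g => hinge (u - g)).

Lemma meanHinge_ge0 u : 0 <= meanHinge u.
Proof. by apply: gaussE_ge0 => g; exact: hinge_ge0. Qed.

Lemma ler_meanHinge : {homo meanHinge : x y / x <= y}.
Proof.
move=> x y xy; apply: gaussE_le => [||g]; [exact: qbounded_hingeB..|].
by rewrite ler_hinge// lerD2r.
Qed.

Lemma measurable_meanHinge : measurable_fun [set: R] meanHinge.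
Proof. exact: nondecreasing_measurable ler_meanHinge. Qed.

Lemma meanHinge_symE u : meanHinge u = gaussE (fun g => hinge (u + g)).
Proof.
rewrite /meanHinge -(gaussEN (qbounded_hingeD u)).
by congr gaussE; apply/funext => g.
Qed.

Lemma meanHingeDN u : meanHinge u + meanHinge (- u) = 1 + u ^+ 2.
Proof.
rewrite (meanHinge_symE (- u)) -gaussED; [|exact: qbounded_hingeB|exact: qbounded_hingeD].
have -> : (fun g => hinge (u - g) + hinge (- u + g)) =
    (fun g => (g ^+ 2 + u ^+ 2) + (- 2 * u) * g).
  apply/funext => g; rewrite (_ : - u + g = - (u - g)); last by ring.
  by rewrite hingeDN; ring.
have q2 := @qbounded_sqr R; have qu := qbounded_cst (u ^+ 2); have qi := @qbounded_id R.
have q := qboundedZ (-2 * u) qi.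
rewrite (gaussED (qboundedD q2 qu) q) (gaussED q2 qu) (gaussEZ _ qi).
by rewrite gaussE_cst gaussE_sqr gaussE_id mulr0 addr0.
Qed.

(** After averaging over g and - g it comes down to hinge (u - |g|) +
    hinge (u + |g|) <= 2 u^2 + 2 u |g| + g^2. *)
Lemma meanHinge_le u : 0 <= u -> meanHinge u <= u ^+ 2 + 2^-1 + 2 * phi 0 * u.
Proof.
move=> u0.
suff : meanHinge u + meanHinge u <= 2 * u ^+ 2 + 1 + 2 * u * (2 * phi 0) by lra.
rewrite {2}meanHinge_symE -gaussED; [|exact: qbounded_hingeB|exact: qbounded_hingeD].
have q2 := @qbounded_sqr R; have qu := qbounded_cst (2 * u ^+ 2).
have qi := qbounded_norm (@qbounded_id R); have q := qboundedZ (2 * u) qi.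
have q3 := qboundedD qu q2.
have -> : 2 * u ^+ 2 + 1 + 2 * u * (2 * phi 0) =
    gaussE (fun g => (2 * u ^+ 2 + g ^+ 2) + 2 * u * `|g|).
  rewrite (gaussED q3 q) (gaussED qu q2) (gaussEZ _ qi).
  by rewrite gaussE_cst gaussE_sqr gaussE_abs.
apply: gaussE_le => [||g].
- by apply: qboundedD; [exact: qbounded_hingeB|exact: qbounded_hingeD].
- exact: qboundedD.
wlog g0 : g / 0 <= g.
  move=> h; have [/h//|g0] := leP 0 g.
  by have := h (- g); rewrite opprK sqrrN normrN [hinge _ + _]addrC; apply; lra.
rewrite ger0_norm// (hinge_pos (addr_ge0 u0 g0)).
have [ug|ug] := leP g u.
  by rewrite hinge_pos; [nra|lra].
by rewrite hinge_neg; [nra|lra].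
Qed.

(** When u^2 >= 1 / 3, both sides are separated by 1 + u^2. For smaller u, the
    bound meanHinge_le starts like Sampford's at 1 / 2 and grows more
    slowly. The inequality fails for very negative u, where the right side
    decays like the square of the left one up to powers of u. *)
Lemma meanHinge_le_invMills u : 0 <= u -> meanHinge u <= invMills u ^+ 2.
Proof.
move=> u0; have [u3|u3] := leP 3^-1 (u ^+ 2).
  apply: le_trans (invMills_sqr_ge1 u0 u3).
  by have := meanHingeDN u; have := meanHinge_ge0 (- u); lra.
apply: le_trans (meanHinge_le u0) _.
apply: le_trans (invMills_sqr_ge _); last by lra.
have := sqr_sqrtr (ltW (sqr_addr_gt0 u (ltr0n R 8))).
have := sqrtr_ge0 (u ^+ 2 + 8); set s := Num.sqrt _ => s0 s2.
(* Slightly below sqrt 8, and slightly above 1 / sqrt 3 next. *)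
have s8 : 2828 / 1000 <= s by apply: ler_of_sqr => //; rewrite s2; nra.
have u6 : u <= 578 / 1000 by apply: ler_of_sqr; [lra|move: u3; clear; lra].
have := @two_phi0_le R; set p := 2 * phi 0 => p8.
have : 0 <= u * (6 * (s - u) - 16 * p) by rewrite mulr_ge0//; lra.
by lra.
Qed.

(** For m >= 0 and v >= 0 the variable m - s Z gives more weight to v than
    to - v. A deficit of B at - v that is made up for at v when the two
    points weigh the same is then made up for a fortiori. With k = m / s,
    the substitution z = w + k and the folding of w onto - w turn this into
    a pointwise inequality between integrands. *)
Lemma gaussE_affine_le (A B : R -> R) m s : 0 <= m -> 0 <= s ->
  qbounded A -> qbounded B -> (forall x, 0 <= A x) -> (forall x, 0 <= B x) ->
  (forall v, 0 <= v -> A v <= B v) ->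
  (forall v, A v + A (- v) <= B v + B (- v)) ->
  gaussE (fun z => A (m - s * z)) <= gaussE (fun z => B (m - s * z)).
Proof.
move=> m0 s0 qA qB A0 B0 AB ABN.
have qaff f : qbounded f -> qbounded (fun z => f (m - s * z)).
  move=> /(qbounded_affine (- s) m); congr qbounded.
  by apply/funext => z; rewrite mulNr addrC.
move: s0; rewrite le_eqVlt => /predU1P[s0|s0].
  by apply: gaussE_le => [||z]; [exact: qaff|exact: qaff|rewrite -s0 mul0r subr0 AB].
pose k := m / s.
have k0 : 0 <= k by rewrite divr_ge0// ltW.
have mA f : qbounded f -> [/\ measurable_fun [set: R] (fun w => f (s * w)),
    measurable_fun [set: R] (fun w => f (- (s * w))),
    measurable_fun [set: R] (fun w => phi (w + k)) &
    measurable_fun [set: R] (fun w => phi (k - w))].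
  move=> qf; split.
  - have := proj1 (qbounded_affine s 0 qf).
    by congr measurable_fun; apply/funext => w; rewrite addr0.
  - have := proj1 (qbounded_affine (- s) 0 qf).
    by congr measurable_fun; apply/funext => w; rewrite addr0 mulNr.
  - by apply: (measurableT_comp (@measurable_phi R)); exact: measurable_funD.
  - by apply: (measurableT_comp (@measurable_phi R)); exact: measurable_funB.
have mE f : qbounded f -> measurable_fun [set: R]
    (fun w => f (- (s * w)) * phi (w + k) + f (s * w) * phi (k - w)).
  by move=> /mA[mZ mN mp1 mp2]; apply: measurable_funD; exact: measurable_funM.
have E f : qbounded f -> (forall x, 0 <= f x) ->
    (\int[mu]_w (f (- (s * w)) * phi (w + k) + f (s * w) * phi (k - w))%:E =
     (2 * gaussE (fun z => f (m - s * z)))%:E)%E.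
  move=> qf f0.
  have [mZ mN mp1 mp2] := mA f qf.
  have I1 : (\int[mu]_w (f (- (s * w)) * phi (w + k))%:E =
      (gaussE (fun z => f (m - s * z)))%:E)%E.
    rewrite -(gaussE_lebesgue (qaff _ qf) (fun z => f0 _)).
    rewrite -[RHS](@lebesgue_integralDr _ _ k); last 2 first.
    - apply/measurable_EFinP.
      exact: (measurable_funM (proj1 (qaff _ qf)) (@measurable_phi R)).
    - by move=> x; rewrite lee_fin mulr_ge0 ?phi_ge0.
    apply: eq_integral => w _; congr (f _ * _)%:E.
    by rewrite /k; field; rewrite gt_eqF.
  have I2 : (\int[mu]_w (f (s * w) * phi (k - w))%:E =
      (gaussE (fun z => f (m - s * z)))%:E)%E.
    rewrite -I1 -[RHS]lebesgue_integralN.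
    - by apply: eq_integral => w _; rewrite mulrN opprK [- w + k]addrC.
    - by apply/measurable_EFinP; exact: (measurable_funM mN mp1).
    - by move=> x; rewrite lee_fin mulr_ge0 ?phi_ge0.
  under eq_integral do rewrite EFinD.
  rewrite ge0_integralD//.
  - by rewrite I1 I2 -EFinD; congr _%:E; ring.
  - by move=> x _; rewrite lee_fin mulr_ge0 ?phi_ge0.
  - by apply/measurable_EFinP; exact: (measurable_funM mN mp1).
  - by move=> x _; rewrite lee_fin mulr_ge0 ?phi_ge0.
  - by apply/measurable_EFinP; exact: (measurable_funM mZ mp2).
suff : 2 * gaussE (fun z => A (m - s * z)) <= 2 * gaussE (fun z => B (m - s * z)).
  by lra.
rewrite -lee_fin -!E//.
apply: ge0_le_integral => //.
- by move=> w _; rewrite lee_fin addr_ge0// mulr_ge0 ?phi_ge0.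
- by apply/measurable_EFinP; apply: mE.
- by apply/measurable_EFinP; apply: mE.
move=> w _; rewrite lee_fin.
(* The two summands are exchanged by w -> - w. *)
wlog w0 : w / 0 <= w.
  move=> h; have [/h//|w0] := leP 0 w.
  have := h (- w); rewrite mulrN opprK opprK [- w + k]addrC [k + w]addrC.
  rewrite [A (s * w) * _ + _]addrC [B (s * w) * _ + _]addrC; apply; lra.
have v0 : 0 <= s * w by rewrite mulr_ge0// ltW.
have pk : phi (w + k) <= phi (k - w).
  rewrite !phiE ler_wpM2l ?invr_ge0 ?sqrtr_ge0// ler_expR.
  by have := mulr_ge0 w0 k0; nra.
have := AB _ v0; have := ABN (s * w); have := phi_ge0 (w + k).
move: (A _) (A _) (B _) (B _) pk => a1 a2 b1 b2; move: (phi _) (phi _) => p1 p2.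
by nra.
Qed.

End Hinge.

(** * Replica-symmetric solutions *)

Section ReplicaSymmetric.
Context {R : realType}.
Implicit Types (kappa q r alpha u x z m s : R).

Lemma qbounded_invMills_sqr m s : qbounded (fun z => invMills (m - s * z) ^+ 2).
Proof.
suff h : qbounded (fun u => invMills u ^+ 2).
  have := qbounded_affine (- s) m h.
  by congr qbounded; apply/funext => z; rewrite mulNr addrC.
apply: (qbounded_le _ (qboundedD qbounded_sqr (qbounded_cst 2))).
- by apply: measurable_funX; apply: continuous_measurable_fun; exact: continuous_invMills.
- by move=> u; rewrite ger0_norm ?sqr_ge0// invMills_sqr_le.
Qed.

Lemma qbounded_meanHinge : qbounded (@meanHinge R).
Proof.
apply: (qbounded_le measurable_meanHinge (qboundedD (qbounded_cst 1) qbounded_sqr)).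
move=> u; rewrite ger0_norm ?meanHinge_ge0// -meanHingeDN lerDl.
exact: meanHinge_ge0.
Qed.

Lemma gaussE_meanHinge_le m s : 0 <= m -> 0 <= s ->
  gaussE (fun z => meanHinge (m - s * z)) <=
  gaussE (fun z => invMills (m - s * z) ^+ 2).
Proof.
move=> m0 s0; apply: (@gaussE_affine_le _ (@meanHinge R) (fun u => invMills u ^+ 2)) => //.
- exact: qbounded_meanHinge.
- have := qbounded_invMills_sqr 0 (-1).
  by congr qbounded; apply/funext => z; rewrite mulN1r opprK add0r.
- exact: meanHinge_ge0.
- by move=> x; exact: sqr_ge0.
- exact: meanHinge_le_invMills.
- by move=> v; rewrite meanHingeDN invMills_sqrD.
Qed.

(** The rotation splits Z into sqrt q z + sqrt (1 - q) g, and the integration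
    over g gives meanHinge. *)
Lemma Ckappa_meanHinge kappa q : 0 <= q < 1 ->
  Ckappa kappa = (1 - q) * gaussE (fun z =>
    meanHinge (kappa / Num.sqrt (1 - q) - Num.sqrt q / Num.sqrt (1 - q) * z)).
Proof.
move=> /andP[q0 q1]; set t := Num.sqrt (1 - q); set a := Num.sqrt q.
have q1' : 0 <= 1 - q by lra.
have t0 : 0 < t by rewrite sqrtr_gt0; lra.
have t2 : t ^+ 2 = 1 - q by rewrite sqr_sqrtr.
have a2 : a ^+ 2 = q by rewrite sqr_sqrtr.
have ch : continuous (fun x => hinge (kappa - x)).
  move=> x; apply: (@continuous_comp _ _ _ (fun x => kappa - x) (@hinge R)).
    by apply: cvgB; [exact: cvg_cst|exact: cvg_id].
  exact: continuous_hinge.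
have := @gaussE_rotation R (fun x => hinge (kappa - x)) a t (fun x => hinge_ge0 _)
  ch (qbounded_hingeB kappa) t0.
rewrite a2 t2 => /(_ ltac:(lra)).
rewrite /Ckappa -/(gaussE (fun z => hinge (kappa - z))) => <-.
rewrite -gaussEZ; last first.
  have := qbounded_affine (- (a / t)) (kappa / t) qbounded_meanHinge.
  by congr qbounded; apply/funext => z; rewrite mulNr addrC.
congr gaussE; apply/funext => z; rewrite -gaussEZ; last exact: qbounded_hingeB.
congr gaussE; apply/funext => g; rewrite -t2 -hingeZ ?(ltW t0)//.
by congr hinge; field; rewrite gt_eqF.
Qed.

Definition meanSqrMills kappa q : R := gaussE (fun z => invMills
  (kappa / Num.sqrt (1 - q) - Num.sqrt q / Num.sqrt (1 - q) * z) ^+ 2).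

Lemma gaussE_Fq kappa q : 0 <= q < 1 ->
  gaussE (fun z => Fq kappa q (Num.sqrt q * z) ^+ 2) =
  (1 - q)^-1 * meanSqrMills kappa q.
Proof.
move=> /andP[q0 q1]; have q1' : 0 <= 1 - q by lra.
have t0 : Num.sqrt (1 - q) != 0 by rewrite gt_eqF// sqrtr_gt0; lra.
rewrite -gaussEZ; last exact: qbounded_invMills_sqr.
congr gaussE; apply/funext => z; rewrite /Fq exprMn exprVn sqr_sqrtr//.
by congr (_ * invMills _ ^+ 2); field.
Qed.

Lemma Ckappa_gt0 kappa : 0 <= kappa -> 0 < Ckappa kappa.
Proof.
move=> k0; apply: gaussE_gt0; first exact: (qbounded_hingeB kappa).
- by move=> x; exact: sqr_ge0.
- by move=> x x1; rewrite exprn_gt0// lt_max; apply/orP; left; lra.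
Qed.

(** The constant 2 / pi in alpha_c is the square of E|Z|. *)
Lemma alpha_c_Ckappa kappa : 0 <= kappa ->
  alpha_c kappa * Ckappa kappa = (2 * phi 0) ^+ 2.
Proof.
move=> k0; rewrite /alpha_c exprMn phi0_sqr.
have := Ckappa_gt0 k0; have := @pi_gt0 R; move: (pi) (Ckappa _) => p c p0 c0.
by field; rewrite !gt_eqF.
Qed.

Definition gaussTanh r : R := gaussE (fun z => z * tanh (Num.sqrt r * z)).

Section Solution.
Variables (kappa alpha q r : R).
Hypotheses (kappa_ge0 : 0 <= kappa) (alpha_gt0 : 0 < alpha).
Hypothesis sol : RS_solution kappa alpha q r.

Lemma RS_solution_tanh : Num.sqrt r * (1 - q) = gaussTanh r.
Proof. by have [_ r0 -> _] := sol; exact: onem_P_tanh. Qed.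

Lemma RS_solution_Mills : alpha * meanSqrMills kappa q = r * (1 - q).
Proof.
have [q01 _ _ rR] := sol.
rewrite [in RHS]rR /Rk gaussE_Fq//; have /andP[_ q1] := q01.
by field; rewrite gt_eqF// subr_gt0.
Qed.

(** At alpha = alpha_c the left side would be the square of E|Z|, a value that
    gaussTanh never reaches. *)
Lemma RS_solution_alpha_le : alpha * Ckappa kappa <= gaussTanh r ^+ 2.
Proof.
have [q01 r0 _ _] := sol; have /andP[q0 q1] := q01.
rewrite -RS_solution_tanh exprMn sqr_sqrtr//.
have -> : r * (1 - q) ^+ 2 = (1 - q) * (alpha * meanSqrMills kappa q).
  by rewrite RS_solution_Mills; ring.
rewrite (Ckappa_meanHinge kappa q01) mulrCA; apply: ler_wpM2l; first by lra.
rewrite ler_wpM2l ?(ltW alpha_gt0)//.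
by apply: gaussE_meanHinge_le; rewrite divr_ge0 ?sqrtr_ge0.
Qed.

End Solution.

Lemma Phi_ge0 u : 0 <= Phi u.
Proof. by apply: Rintegral_ge0 => // x _; exact: phi_ge0. Qed.

Lemma ln_Phibar_le0 u : ln (Phibar u) <= 0.
Proof. by apply: ln_le0; rewrite /Phibar; have := Phi_ge0 u; lra. Qed.

Lemma Phibar_mul_invMills u : Phibar u * invMills u = phi u.
Proof. by rewrite /invMills mulrC divfK// gt_eqF// Phibar_gt0. Qed.

Lemma phi_half_le u : phi u <= 2^-1 * expR (- (u ^+ 2 / 2)).
Proof.
have -> : phi u = phi 0 * expR (- (u ^+ 2 / 2)).
  by rewrite !phiE expr0n/= mul0r oppr0 expR0 mulr1.
rewrite ler_wpM2r ?expR_ge0//.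
by have := @two_phi0_le R; lra.
Qed.

(** This makes the logarithm of Phibar quadratically bounded, hence its
    expectation finite. *)
Lemma ln_Phibar_ge u : ln (phi 0) - 2 - 2 * u ^+ 2 <= ln (Phibar u).
Proof.
have s0 : 0 < u ^+ 2 + 2 by rewrite ltr_wpDl ?sqr_ge0.
have := Phibar_ge u; rewrite -ler_ln ?posrE ?Phibar_gt0//; last first.
  by rewrite divr_gt0 ?phi_gt0// sqrtr_gt0.
apply: le_trans.
have -> : phi u = phi 0 * expR (- (u ^+ 2 / 2)).
  by rewrite !phiE expr0n/= mul0r oppr0 expR0 mulr1.
rewrite ln_div ?posrE ?mulr_gt0 ?phi_gt0 ?expR_gt0 ?sqrtr_gt0//.
rewrite lnM ?posrE ?phi_gt0 ?expR_gt0// expRK.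
have : ln (Num.sqrt (u ^+ 2 + 2)) <= Num.sqrt (u ^+ 2 + 2).
  have w0 : -1 < Num.sqrt (u ^+ 2 + 2) - 1 by have : 0 < Num.sqrt (u ^+ 2 + 2); [rewrite sqrtr_gt0|lra].
  by have := le_ln1Dx w0; rewrite [1 + _]addrC subrK; lra.
have := sqr_sqrtr (ltW s0); have := sqrtr_ge0 (u ^+ 2 + 2).
by set w := Num.sqrt _ => w0 w2; nra.
Qed.

(** The Gaussian exponent - u^2 / 2 is traded for - E(u)^2 / 2 because the
    expectation of E(u)^2 is known exactly from RS_solution_Mills. *)
Lemma ln_Phibar_le_sqr u : ln (Phibar u) <= - (invMills u ^+ 2 / 2) + 1.
Proof.
have [u0|/ltW u0] := leP 0 u; last first.
  by have := invMills_le0 u0; have := ln_Phibar_le0 u; lra.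
suff : Phibar u <= expR (- (u ^+ 2 / 2)).
  rewrite -ler_ln ?posrE ?Phibar_gt0 ?expR_gt0// expRK.
  by have := invMills_sqr_le u; lra.
have E2 : 2^-1 <= invMills u.
  apply: le_trans (invMills_ge_sampford _); last by lra.
  have : 2 <= Num.sqrt (u ^+ 2 + 8).
    apply: ler_of_sqr; rewrite ?sqrtr_ge0// sqr_sqrtr; last exact/ltW/sqr_addr_gt0.
    by have := sqr_ge0 u; lra.
  by rewrite /sampford; lra.
have := phi_half_le u; rewrite -Phibar_mul_invMills.
by have := Phibar_gt0 u; nra.
Qed.

(** The extra logarithm comes from Phibar = phi / E and E(u) >= u >= Y. *)
Lemma ln_Phibar_le_ln u (Y : R) : 1 <= Y -> Y <= u ->
  ln (Phibar u) <= - (invMills u ^+ 2 / 2) + 1 - ln Y.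
Proof.
move=> Y1 Yu; have Y0 : 0 < Y by lra.
suff : Phibar u <= expR (- (u ^+ 2 / 2)) / Y.
  rewrite -ler_ln ?posrE ?Phibar_gt0 ?divr_gt0 ?expR_gt0// ln_div ?posrE ?expR_gt0//.
  by rewrite expRK; have := invMills_sqr_le u; lra.
rewrite ler_pdivlMr//.
have E2 : Y <= invMills u by apply: le_trans (invMills_ge_id _); lra.
have := phi_half_le u; rewrite -Phibar_mul_invMills; have := expR_gt0 (- (u ^+ 2 / 2)).
by have := Phibar_gt0 u; nra.
Qed.

Lemma two_cosh x : 2 * cosh x = expR x + expR (- x).
Proof. by rewrite /cosh; field. Qed.

Lemma cosh_norm x : cosh `|x| = cosh x.
Proof. by have [//|x0] := ger0P x; rewrite /cosh opprK [expR (- x) + _]addrC. Qed.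

(** The difference log (2 cosh x) - x tanh x is the entropy of a spin of mean
    tanh x, hence bounded. *)
Lemma ln_cosh_le x : ln (2 * cosh x) <= x * tanh x + 2.
Proof.
wlog x0 : x / 0 <= x.
  move=> h; have := h `|x| (normr_ge0 x); rewrite cosh_norm.
  by have := mul_tanh_norm x (@ler01 R); rewrite !mul1r => ->.
rewrite two_cosh.
have e0 := expR_gt0 x; have e'0 := expR_gt0 (- x).
have ee : expR x * expR (- x) = 1 by rewrite -expRD subrr expR0.
have e1 := expR_ge1Dx x.
have lnle : ln (expR x + expR (- x)) <= x + 1.
  rewrite -ler_expR lnK ?posrE ?addr_gt0// expRD.
  by have := expR_ge1Dx (1 : R); nra.
have : x - x * tanh x <= 1.
  have -> : x - x * tanh x = 2 * x * expR (- x) / (expR x + expR (- x)).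
    by rewrite /tanh; field; rewrite gt_eqF// addr_gt0.
  rewrite ler_pdivrMr ?addr_gt0// mul1r.
  nra.
by lra.
Qed.

Lemma ln_cosh_ge0 x : 0 <= ln (2 * cosh x).
Proof.
rewrite two_cosh ln_ge0//.
have := expR_ge1Dx x; have := expR_ge1Dx (- x); lra.
Qed.

Lemma qbounded_ln_cosh (a : R) : qbounded (fun z => ln (2 * cosh (a * z))).
Proof.
have q := qboundedD (qboundedZ a (qbounded_mul_tanh a)) (qbounded_cst 2).
apply: (qbounded_le _ q) => [|z].
- apply: (measurableT_comp (@measurable_ln R)).
  apply: continuous_measurable_fun => x.
  under eq_fun do rewrite two_cosh.
  by apply: cvgD; apply: continuous_comp; try exact: continuous_expR;
    [|apply: cvgN]; exact: mulrl_continuous.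
- by rewrite ger0_norm ?ln_cosh_ge0// mulrA ln_cosh_le.
Qed.

Lemma qbounded_ln_Phibar m s : qbounded (fun z => ln (Phibar (m - s * z))).
Proof.
suff h : qbounded (fun u => ln (Phibar u)).
  have := qbounded_affine (- s) m h.
  by congr qbounded; apply/funext => z; rewrite mulNr addrC.
have q := qboundedD (qbounded_cst (- ln (phi 0) + 2)) (qboundedZ 2 (@qbounded_sqr R)).
apply: (qbounded_le _ q) => [|u].
- apply: (measurableT_comp (@measurable_ln R)).
  apply: continuous_measurable_fun => x.
  exact: is_derive_continuous (is_derive_Phibar x).
- by rewrite ler0_norm ?ln_Phibar_le0//; have := ln_Phibar_ge u; lra.
Qed.

(** An event of positive probability on which kappa - sqrt q z >= sqrt q, so
    that the argument of Phibar is large when q is close to 1. *)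
Definition leftTail : R -> R := \1_`]-oo, -1]%classic.

Lemma leftTailE x : leftTail x = if x <= -1 then 1 else 0.
Proof. by rewrite /leftTail indicE mem_setE in_itv/=; case: (x <= -1). Qed.

Lemma qbounded_leftTail : qbounded leftTail.
Proof.
apply: (qbounded_le _ (qbounded_cst 1)).
  exact: measurable_indic.
by move=> x; rewrite leftTailE; case: ifP => _; rewrite ?normr1 ?normr0.
Qed.

Lemma gaussE_leftTail_gt0 : 0 < gaussE leftTail.
Proof.
apply: gaussE_gt0; first exact: qbounded_leftTail.
- by move=> x; rewrite leftTailE; case: ifP.
- by move=> x x1; rewrite leftTailE x1.
Qed.

(** The three terms of order r (1 - q) have coefficients - 1 / 2, 1 and - 1 / 2;
    there remain bounded terms and the logarithmic gain on the left tail. *)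
Lemma RS_functional_le kappa alpha q r (Y : R) : 0 <= kappa -> 0 < alpha ->
  RS_solution kappa alpha q r -> 1 <= Y -> Y * Num.sqrt (1 - q) <= Num.sqrt q ->
  RS_functional kappa alpha q r <=
  2 + alpha - alpha * (gaussE leftTail * ln Y).
Proof.
move=> k0 a0 sol Y1 Yq; have [/andP[q0 q1] r0 _ _] := sol.
have t0 : 0 < Num.sqrt (1 - q) by rewrite sqrtr_gt0; lra.
have hM := RS_solution_Mills sol; have hT := RS_solution_tanh sol.
set m := kappa / Num.sqrt (1 - q); set s := Num.sqrt q / Num.sqrt (1 - q).
rewrite /meanSqrMills -/m -/s in hM.
have m0 : 0 <= m by rewrite divr_ge0 ?sqrtr_ge0.
have Ys : Y <= s by rewrite ler_pdivlMr.
have L1 : gaussE (fun z => ln (2 * cosh (Num.sqrt r * z))) <= r * (1 - q) + 2.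
  have -> : r * (1 - q) = Num.sqrt r * gaussTanh r.
    by rewrite -hT mulrA -expr2 sqr_sqrtr.
  have qt := qbounded_mul_tanh (Num.sqrt r).
  rewrite /gaussTanh -(gaussEZ _ qt) -{2}(gaussE_cst 2).
  rewrite -(gaussED (qboundedZ _ qt) (qbounded_cst 2)).
  apply: gaussE_le; [exact: qbounded_ln_cosh| |].
    exact: (qboundedD (qboundedZ _ qt) (qbounded_cst 2)).
  by move=> z; rewrite mulrA ln_cosh_le.
have L2 : gaussE (fun z => ln (Phibar ((kappa - Num.sqrt q * z) / Num.sqrt (1 - q)))) <=
    - 2^-1 * gaussE (fun z => invMills (m - s * z) ^+ 2) + (1 - ln Y * gaussE leftTail).
  have -> : (fun z => ln (Phibar ((kappa - Num.sqrt q * z) / Num.sqrt (1 - q)))) =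
      (fun z => ln (Phibar (m - s * z))).
    by apply/funext => z; congr (ln (Phibar _)); rewrite /m /s; field; rewrite gt_eqF.
  have qM := qboundedZ (- 2^-1) (qbounded_invMills_sqr m s).
  have qL := qboundedZ (- ln Y) qbounded_leftTail.
  have q1L := qboundedD (qbounded_cst 1) qL.
  rewrite -(gaussEZ _ (qbounded_invMills_sqr m s)) -mulNr -(gaussEZ _ qbounded_leftTail).
  rewrite -[in X in _ + X](gaussE_cst 1) -(gaussED (qbounded_cst 1) qL) -(gaussED qM q1L).
  apply: gaussE_le; [exact: qbounded_ln_Phibar|exact: qboundedD|move=> z].
  rewrite leftTailE; case: ifPn => z1.
    have /(ln_Phibar_le_ln Y1) : Y <= m - s * z by nra.
    by rewrite mulr1; lra.
  by have := ln_Phibar_le_sqr (m - s * z); rewrite mulr0; lra.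
have aL2 := ler_wpM2l (ltW a0) L2.
by rewrite /RS_functional; lra.
Qed.

End ReplicaSymmetric.

(** * Divergence at the critical load *)

Lemma gaussTanh_lt (R : realType) (r : R) : gaussTanh r < 2 * phi 0.
Proof. exact: gaussE_mul_tanh_lt (sqrtr_ge0 _). Qed.

Lemma gaussTanh_ge0 (R : realType) (r : R) : 0 <= gaussTanh r.
Proof. by apply: gaussE_ge0 => z; rewrite mul_tanh_ge0 ?sqrtr_ge0. Qed.

(** By RS_solution_alpha_le and the monotonicity of gaussTanh. *)
Lemma RS_solution_gt (R : realType) (kappa alpha q r r0 : R) :
  0 <= kappa -> 0 < alpha -> RS_solution kappa alpha q r ->
  gaussTanh r0 ^+ 2 < alpha * Ckappa kappa -> r0 < r.
Proof.
move=> k0 a0 sol; rewrite [r0 < r]ltNge; apply: contraTN => rr0.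
rewrite -leNgt; apply: le_trans (RS_solution_alpha_le k0 a0 sol) _.
rewrite lerXn2r ?nnegrE ?gaussTanh_ge0//.
by apply: gaussE_mul_tanh_mono; rewrite ?sqrtr_ge0// ler_wsqrtr.
Qed.

(** As sqrt r (1 - q) < 1, a large r forces q towards 1. *)
Lemma RS_solution_sqrt_le (R : realType) (kappa alpha q r Y : R) :
  RS_solution kappa alpha q r -> 0 <= Y -> (1 + Y ^+ 2) ^+ 2 < r ->
  Y * Num.sqrt (1 - q) <= Num.sqrt q.
Proof.
move=> sol Y0 Yr; have [/andP[q0 q1] r0 _ _] := sol.
have hT := RS_solution_tanh sol; have tl := gaussTanh_lt r.
have p0 := @two_phi0_le R.
have s0 := sqrtr_ge0 r; have s2 := sqr_sqrtr r0.
have sY : 1 + Y ^+ 2 <= Num.sqrt r.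
  by apply: ler_of_sqr => //; rewrite s2 ltW.
apply: ler_of_sqr; first exact: sqrtr_ge0.
rewrite exprMn !sqr_sqrtr ?subr_ge0 ?(ltW q1)//.
have : (1 + Y ^+ 2) * (1 - q) <= Num.sqrt r * (1 - q) by rewrite ler_wpM2r// subr_ge0 ltW.
by lra.
Qed.

Theorem theorem3 (R : realType) (kappa : R) (kappa_ge0 : 0 <= kappa)
    (q r : R -> R)
    (qr_sol : forall alpha : R, 0 < alpha < alpha_c kappa ->
      RS_solution kappa alpha (q alpha) (r alpha)) :
  RS_functional kappa alpha (q alpha) (r alpha)
    @[alpha --> (alpha_c kappa)^'-] --> -oo.
Proof.
have C0 := Ckappa_gt0 kappa_ge0; have p0 := @gaussE_leftTail_gt0 R.
have acC := alpha_c_Ckappa kappa_ge0.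
have ac0 : 0 < alpha_c kappa.
  by rewrite -(pmulr_lgt0 _ C0) acC exprn_gt0// mulr_gt0// phi_gt0.
apply/cvgrNyPle => A.
(* Chosen so that the gain at alpha_c / 2 brings the bound below A. *)
pose L := `|2 + alpha_c kappa - A| / (alpha_c kappa / 2 * gaussE leftTail).
have d0 : 0 < alpha_c kappa / 2 * gaussE leftTail by rewrite mulr_gt0// divr_gt0.
have L0 : 0 <= L by rewrite divr_ge0// ltW.
have Y1 : 1 <= expR L by rewrite -expR0 ler_expR.
(* Beyond r0, RS_solution_sqrt_le applies with Y = expR L. *)
pose r0 := (1 + expR L ^+ 2) ^+ 2.
have a1 : gaussTanh r0 ^+ 2 / Ckappa kappa < alpha_c kappa.
  rewrite ltr_pdivrMr// acC.
  by have := gaussTanh_ge0 r0; have := gaussTanh_lt r0; nra.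
have a2 : alpha_c kappa / 2 < alpha_c kappa by lra.
near=> alpha.
have alt : alpha < alpha_c kappa by near: alpha; exact: nbhs_left_lt.
have agt : alpha_c kappa / 2 < alpha by near: alpha; exact: nbhs_left_gt.
have aC : gaussTanh r0 ^+ 2 < alpha * Ckappa kappa.
  by rewrite -ltr_pdivrMr//; near: alpha; exact: nbhs_left_gt.
have a0 : 0 < alpha by lra.
have /qr_sol sol : 0 < alpha < alpha_c kappa by rewrite a0.
have rr0 := RS_solution_gt kappa_ge0 a0 sol aC.
have hY := RS_solution_sqrt_le sol (expR_ge0 L) rr0.
apply: le_trans (RS_functional_le kappa_ge0 a0 sol Y1 hY) _.
rewrite expRK.
have : alpha_c kappa / 2 * gaussE leftTail * L = `|2 + alpha_c kappa - A|.
  by rewrite mulrC divfK// gt_eqF.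
have := ler_norm (2 + alpha_c kappa - A).
have : alpha_c kappa / 2 * (gaussE leftTail * L) <= alpha * (gaussE leftTail * L).
  by rewrite ler_wpM2r ?(ltW agt)// mulr_ge0// ltW.
by lra.
Unshelve. all: by end_near. Qed.
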